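(* Let $k$ be a field of characteristic $p>0$, $k[\mathbf x]=k[x_1,\dots,x_n]$, and let $\mathbf w\in(\Gamma_+)^n$ be a weight, where $\Gamma$ is a totally ordered $\mathbb Q$-vector space. Let $r\ge1$, $\mathbf f=(f_1,\dots,f_r)\in k[\mathbf x]^r$ and $g\in k[\mathbf x]$ be such that $d\mathbf f\wedge dg\ne0$. Then for every nonzero $P\in k[\mathbf f][T]$ one has $$\deg_{\mathbf w}P(g)\ \ge\ \deg_{\mathbf w_g}P-m_{\mathbf w}^g(P)\,\Lambda_0-v_p\bigl(m_{\mathbf w}^g(P)!\bigr)\,\Lambda_1,$$ where $$\Lambda_0=\deg_{\mathbf w}d\mathbf f+\deg_{\mathbf w}g-\deg_{\mathbf w}(d\mathbf f\wedge dg),\qquad \Lambda_1=\deg_{\mathbf w}\mathbf f+\deg_{\mathbf w}g-\deg_{\mathbf w}(d\mathbf f\wedge dg).$$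
   Context: A totally ordered $\mathbb Q$-vector space is a $\mathbb Q$-vector space $\Gamma$ with a total order such that $\alpha\le\beta$ implies $\alpha+\gamma\le\beta+\gamma$; $\Gamma_+=\{\gamma\in\Gamma:\gamma>0\}$. For $f=\sum_{\mathbf i}c_{\mathbf i}\mathbf x^{\mathbf i}\in k[\mathbf x]$, $\deg_{\mathbf w}f=\max\{\sum_l i_lw_l:c_{\mathbf i}\ne0\}$ ($\deg_{\mathbf w}0=-\infty$), and $f^{\mathbf w}$ is the sum of the terms of $f$ of maximal weight. The same notation is used for other polynomial rings and weights. For $\omega=\sum_{i_1<\cdots<i_s}f_{i_1\dots i_s}\,dx_{i_1}\wedge\cdots\wedge dx_{i_s}\in\bigwedge^s\Omega_{k[\mathbf x]/k}$, $\deg_{\mathbf w}\omega=\max\{\deg_{\mathbf w}f_{i_1\dots i_s}+w_{i_1}+\cdots+w_{i_s}\}$. For $\mathbf f=(f_1,\dots,f_r)$: $d\mathbf f=df_1\wedge\cdots\wedge df_r$, $\deg_{\mathbf w}\mathbf f=\sum_i\deg_{\mathbf w}f_i$, $k[\mathbf f]=k[f_1,\dots,f_r]$. $T$ is a variable; $P(g)$ denotes substitution of $g$ for $T$. For $g\in k[\mathbf x]\setminus k$, $\mathbf w_g=(\mathbf w,\deg_{\mathbf w}g)\in(\Gamma_+)^{n+1}$ is a weight on $k[\mathbf x][T]$ where $T$ is the $(n+1)$-st variable; thus for $P=\sum_ip_iT^i$, $\deg_{\mathbf w_g}P=\max_i\deg_{\mathbf w}(p_ig^i)$ and $P^{\mathbf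 w_g}=\sum_{i\in I}p_i^{\mathbf w}T^i$ with $I=\{i:\deg_{\mathbf w}(p_ig^i)=\deg_{\mathbf w_g}P\}$. For $P\neq 0$, $m_{\mathbf w}^g(P)\in\mathbb Z_{\ge0}$ is the multiplicity of $g^{\mathbf w}$ as a root of $P^{\mathbf w_g}$, i.e. $P^{\mathbf w_g}=(T-g^{\mathbf w})^{m_{\mathbf w}^g(P)}P_0$ with $P_0\in k[\mathbf x][T]$, $P_0(g^{\mathbf w})\ne0$. $v_p(m)$ is the exponent of $p$ in the positive integer $m$. *)

(* Defs.v *)
From HB Require Import structures.
From mathcomp Require Import all_boot all_order all_algebra.
From mathcomp Require Import mpoly.

Set Implicit Arguments.
Unset Strict Implicit.
Unset Printing Implicit Defensive.

Import Order.TTheory GRing.Theory Num.Theory.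
Local Open Scope ring_scope.

(* Totality is an axiom of the mixin rather than a join with [Order.Total]:
   joining [Order.Total] with a non-ring additive structure is rejected by the
   MathComp hierarchy, where the two first meet in [Num.RealDomain]. *)
HB.mixin Record isTotallyOrderedQVect V
    of Num.POrderedZmodule V & GRing.Lmodule rat V := {
  ogle_total : forall x y : V, (x <= y) || (y <= x);
  ogle_add2r : forall x y z : V, x <= y -> x + z <= y + z
}.

#[short(type="orderedQVectType")]
HB.structure Definition OrderedQVect :=
  { V of isTotallyOrderedQVect V & Num.POrderedZmodule V
       & GRing.Lmodule rat V }.

(* Degrees live in [option Gamma], where [None] stands for -oo. *)
Section ExtendedDegrees.
Variable Gamma : orderedQVectType.

Definition xle (a b : option Gamma) : bool :=
  match a, b with
  | None, _ => true
  | Some _, None => false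
  | Some x, Some y => x <= y
  end.

Definition xmax (a b : option Gamma) : option Gamma := if xle a b then b else a.

(* The junk value 0 at -oo is only a device to subtract degrees in [Gamma]. *)
Definition xfin (a : option Gamma) : Gamma := odflt 0 a.

End ExtendedDegrees.

Section WeightedDegree.
Variables (Gamma : orderedQVectType) (k : fieldType) (n : nat).
Variable w : 'I_n -> Gamma.
Implicit Types (f g : {mpoly k[n]}) (P : {poly {mpoly k[n]}}).

Definition mweight (m : 'X_{1..n}) : Gamma := \sum_(l < n) w l *+ m l.

Definition wdeg f : option Gamma :=
  \big[@xmax Gamma/None]_(m <- msupp f) Some (mweight m).

Definition winit f : {mpoly k[n]} :=
  \sum_(m <- msupp f | Some (mweight m) == wdeg f) f@_m *: 'X_[m].

Definition wdeg_tuple r (f : r.-tuple {mpoly k[n]}) : Gamma :=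
  \sum_(i < r) xfin (wdeg (tnth f i)).

(* The same notions on k[x][T] for the weight (w, gamma), whose last entry
   gamma is the weight of T. *)
Definition wdegT (gamma : Gamma) P : option Gamma :=
  \big[@xmax Gamma/None]_(i < size P)
     \big[@xmax Gamma/None]_(m <- msupp P`_i) Some (mweight m + gamma *+ i).

Definition winitT (gamma : Gamma) P : {poly {mpoly k[n]}} :=
  \poly_(i < size P)
     \sum_(m <- msupp P`_i | Some (mweight m + gamma *+ i) == wdegT gamma P)
        P`_i@_m *: 'X_[m].

End WeightedDegree.

(* For P != 0, [root_mult P a] is the m such that P = Q * ('X - a%:P) ^+ m with
   Q.[a] != 0; [mup] is only available over a field. *)
Definition root_mult (R : idomainType) (P : {poly R}) (a : R) : nat :=
  sval (multiplicity_XsubC P a).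

Definition init_mult (Gamma : orderedQVectType) (k : fieldType) (n : nat)
    (w : 'I_n -> Gamma) (g : {mpoly k[n]}) (P : {poly {mpoly k[n]}}) : nat :=
  root_mult (winitT w (xfin (wdeg w g)) P) (winit w g).

(* The exterior algebra of the free k[x]-module Omega_{k[x]/k} with basis
   dx_1, ..., dx_n: the coefficient of omega at I = {i_1 < ... < i_s} is the
   coefficient of dx_{i_1} /\ ... /\ dx_{i_s}. *)
Section Forms.
Variables (k : fieldType) (n : nat).

Local Notation form := {ffun {set 'I_n} -> {mpoly k[n]}}.

Definition form1 : form := [ffun K => (K == set0)%:R].

(* For disjoint I and J, dx_I /\ dx_J = (-1) ^ (inversions I J) dx_(I :|: J). *)
Definition inversions (I J : {set 'I_n}) : nat :=
  #|[set ij : 'I_n * 'I_n | [&& ij.1 \in I, ij.2 \in J & (ij.2 < ij.1)%N]]|.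

Definition wedge (omega eta : form) : form :=
  [ffun K : {set 'I_n} =>
    \sum_(I : {set 'I_n} | I \subset K)
       (-1) ^+ inversions I (K :\: I) * (omega I * eta (K :\: I))].

Definition diff (f : {mpoly k[n]}) : form :=
  [ffun K : {set 'I_n} => \sum_(i < n | K == [set i]) f^`M(i)].

Definition diff_tuple r (f : r.-tuple {mpoly k[n]}) : form :=
  \big[wedge/form1]_(i < r) diff (tnth f i).

Definition wdeg_form (Gamma : orderedQVectType) (w : 'I_n -> Gamma)
    (omega : form) : option Gamma :=
  \big[@xmax Gamma/None]_(I : {set 'I_n})
     omap (fun a => a + \sum_(i in I) w i) (wdeg w (omega I)).

End Forms.

Definition in_subalgebra (k : fieldType) (n r : nat)
    (f : r.-tuple {mpoly k[n]}) (h : {mpoly k[n]}) : Prop :=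
  exists q : {mpoly k[r]}, h = q \mPo f.

(* When df /\ dg != 0, the forms df and df /\ dg and the polynomials f_i and g
   are all nonzero, so [xfin] is only applied to finite degrees below. *)
Section Lambda.
Variables (Gamma : orderedQVectType) (k : fieldType) (n r : nat).
Variables (w : 'I_n -> Gamma) (f : r.-tuple {mpoly k[n]}) (g : {mpoly k[n]}).

Definition Lambda0 : Gamma :=
  xfin (wdeg_form w (diff_tuple f)) + xfin (wdeg w g)
  - xfin (wdeg_form w (wedge (diff_tuple f) (diff g))).

Definition Lambda1 : Gamma :=
  wdeg_tuple w f + xfin (wdeg w g)
  - xfin (wdeg_form w (wedge (diff_tuple f) (diff g))).

End Lambda.

(* Main.v *)
(** Let [z = (g, f_1, .., f_r)] and let [I] index a coefficient of [dz] of maximal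
degree. Since [dz] is nonzero, [z] together with the [x_j], [j \notin I], is a
separating transcendence basis of [K = k(x)] over [k], so [K] carries the iterative
Hasse-Schmidt derivation [D_0, D_1, ..] along [g] that fixes the other coordinates,
and [D_m (P(g)) = P^`N(m)(g)] when the coefficients of [P] lie in [k[f]]. For
[m = m_w^g(P)], the initial form of [P^`N(m)(g)] is [P_0(g^w)], of degree
[deg P - m deg g], so the theorem says that [D_m] raises degrees by at most
[m * lambda + v_p(m!) * Lambda1] with [lambda = deg df - deg (df /\ dg)].

This is shown by induction on [m]. For [m = 1], [D_1 h] is a quotient of coefficients
of [df /\ dh] and [df /\ dg]. If ['C(m, j)] is prime to [p] for some [0 < j < m],
then [D_m] is a multiple of [D_j D_(m-j)], and the bound is additive. Otherwise
[v_p(m!) >= v_p(j!) + v_p((m-j)!) + 1] for all such [j]; the Leibniz rule bounds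
[D_m] minus a derivation with one [Lambda1] to spare, and this [Lambda1] is the price
of the derivation, which is determined by its values on [z]. *)

Require Import Defs.
From HB Require Import structures.
From mathcomp Require Import all_boot all_order all_algebra.
From mathcomp Require Import mpoly.
From mathcomp Require Import ring zify.
Import Order.TTheory GRing.Theory Num.Theory.
Local Open Scope ring_scope.

Set Implicit Arguments.
Unset Strict Implicit.
Unset Printing Implicit Defensive.

(** * Inequalities in ordered vector spaces *)

Section OrderedGroup.
Variable Gamma : orderedQVectType.
Implicit Types a b c d : Gamma.

Lemma ogle_add a b c d : a <= b -> c <= d -> a + c <= b + d.
Proof.
move=> lab lcd; apply: le_trans (ogle_add2r a b c lab) _.
by rewrite ![b + _]addrC; apply: ogle_add2r.
Qed.

Lemma ogleD2r c a b : (a + c <= b + c) = (a <= b).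
Proof.
apply/idP/idP => [|H]; last exact: ogle_add2r.
by move/(@ogle_add2r _ _ _ (- c)); rewrite !addrK.
Qed.

Lemma ogleD2l c a b : (c + a <= c + b) = (a <= b).
Proof. by rewrite ![c + _]addrC ogleD2r. Qed.

Lemma oglt_le_add a b c d : a < b -> c <= d -> a + c < b + d.
Proof.
move=> lab lcd; rewrite lt_neqAle ogle_add ?(ltW lab) // andbT.
apply/eqP => E; move: lab; rewrite lt_neqAle => /andP[/negP ab lab]; apply: ab.
rewrite eq_le lab /= -(ogleD2r c) E.
by rewrite ogleD2l.
Qed.

Lemma ogle_subr a b c : (a <= b - c) = (a + c <= b).
Proof. by rewrite -[LHS](ogleD2r c) subrK. Qed.

Lemma ogle_subl a b c : (a - c <= b) = (a <= b + c).
Proof. by rewrite -[LHS](ogleD2r c) subrK. Qed.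

Lemma ogle_mulrn a m n : 0 <= a -> (m <= n)%N -> a *+ m <= a *+ n.
Proof.
move=> a0 /subnK <-; elim: (n - m)%N => // d IH; rewrite addSn mulrS.
by rewrite -[X in X <= _]add0r ogle_add.
Qed.

End OrderedGroup.

Lemma mpoly_closure (R : nzRingType) (n : nat) (Q : {mpoly R[n]} -> Prop) :
    (forall c, Q c%:MP) -> (forall i, Q 'X_i) ->
    (forall p q, Q p -> Q q -> Q (p + q)) ->
    (forall p q, Q p -> Q q -> Q (p * q)) ->
  forall p, Q p.
Proof.
move=> QC QX QD QM; elim/mpolyind => [|c m p _ _ Qp]; first by rewrite -mpolyC0.
apply: (QD) Qp; rewrite -mul_mpolyC; apply: (QM) => //.
have Q1 : Q 1 by rewrite -mpolyC1.
rewrite mpolyXE_id; apply: (big_ind Q) => // i _.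
by elim: (m i) => [|j IH]; rewrite ?expr0 ?exprS //; apply: (QM).
Qed.

(** * Weighted degree bounds *)

Section WeightBound.
Variables (Gamma : orderedQVectType) (k : fieldType) (n : nat).
Variable w : 'I_n -> Gamma.
Implicit Types (f g h : {mpoly k[n]}) (m : 'X_{1..n}) (a b c : Gamma).

Local Notation wt := (Defs.mweight w).

Lemma mweight0 : wt 0%MM = 0.
Proof. by rewrite /Defs.mweight big1 // => i _; rewrite mnm0E mulr0n. Qed.

Lemma mweightD m1 m2 : wt (m1 + m2)%MM = wt m1 + wt m2.
Proof.
by rewrite /Defs.mweight -big_split; apply: eq_bigr => i _; rewrite mnmDE mulrnDr.
Qed.

Lemma mweightU i : wt U_(i)%MM = w i.
Proof.
rewrite /Defs.mweight (bigD1 i) //= mnm1E eqxx mulr1n big1 ?addr0 // => j ji.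
by rewrite mnm1E eq_sym (negPf ji) mulr0n.
Qed.

(** The relation deg h <= c with c in [Gamma]. It holds for h = 0 and every c, so bounds need no
    case distinction at -oo. *)
Definition wle h c := all (fun m => wt m <= c) (msupp h).

Lemma wleP h c : reflect (forall m, h@_m != 0 -> wt m <= c) (wle h c).
Proof.
apply: (iffP allP) => H m; first by rewrite -mcoeff_msupp; apply: H.
by rewrite mcoeff_msupp; apply: H.
Qed.

Lemma wle_trans h a b : wle h a -> a <= b -> wle h b.
Proof. by move=> /wleP ha ab; apply/wleP => m /ha /le_trans; apply. Qed.

Lemma wle0 c : wle 0 c.
Proof. by apply/wleP => m; rewrite mcoeff0 eqxx. Qed.

Lemma wleC (x : k) : wle x%:MP 0.
Proof.
apply/wleP => m; rewrite mcoeffC; case: (m =P _) => [->|_].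
  by rewrite mweight0.
by rewrite mulr0 eqxx.
Qed.

Lemma wleX m : wle 'X_[m] (wt m).
Proof.
apply/wleP => m'; rewrite mcoeffX; case: (m =P _) => [->|_] //.
by rewrite eqxx.
Qed.

Lemma wleD f g c : wle f c -> wle g c -> wle (f + g) c.
Proof.
move=> /wleP hf /wleP hg; apply/wleP => m; rewrite mcoeffD => nz.
have [E|/hf //] := eqVneq f@_m 0.
by apply: hg; rewrite E add0r in nz.
Qed.

Lemma wleN f c : wle f c -> wle (- f) c.
Proof.
move=> /wleP hf; apply/wleP => m; rewrite mcoeffN oppr_eq0; exact: hf.
Qed.

Lemma wle_sum (I : Type) (r : seq I) (P : pred I) (F : I -> {mpoly k[n]}) c :
  (forall i, P i -> wle (F i) c) -> wle (\sum_(i <- r | P i) F i) c.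
Proof.
move=> H; apply: (big_ind (wle ^~ c)) => //; first exact: wle0.
by move=> *; apply: wleD.
Qed.

Lemma wleM f g a b : wle f a -> wle g b -> wle (f * g) (a + b).
Proof.
move=> /allP hf /allP hg; apply/allP => m.
move=> /msuppM_le /allpairsP[[m1 m2] /= [h1 h2 ->]].
by rewrite mweightD; apply: ogle_add; [apply: hf | apply: hg].
Qed.

Lemma wle_signM s f c : wle f c -> wle ((-1) ^+ s * f) c.
Proof.
by rewrite -signr_odd mulr_sign; case: (odd s) => //; apply: wleN.
Qed.

Lemma wle_deriv i f c : wle f c -> wle f^`M(i) (c - w i).
Proof.
move=> /wleP hf; apply/wleP => m; rewrite mcoeff_deriv => nz.
rewrite ogle_subr -(mweightU i) -mweightD; apply: hf.
by apply: contraNneq nz => ->; rewrite mul0rn.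
Qed.

Lemma xle_trans (a b c : option Gamma) : xle a b -> xle b c -> xle a c.
Proof. by case: a b c => [a|] [b|] [c|] //=; apply: le_trans. Qed.

Lemma xle_max (a b : option Gamma) c :
  xle (xmax a b) (Some c) = xle a (Some c) && xle b (Some c).
Proof.
rewrite /xmax; case: ifP => ab.
  by case: (boolP (xle b (Some c))) => [H|]; rewrite ?andbF ?(xle_trans ab H).
have ba : xle b a.
  case: a b ab => [a|] [b|] //= ab.
  by have := ogle_total a b; rewrite ab.
by case: (boolP (xle a (Some c))) => [H|] //; rewrite (xle_trans ba H).
Qed.

Lemma xle_big (I : Type) (r : seq I) (F : I -> option Gamma) c :
  xle (\big[@xmax Gamma/None]_(i <- r) F i) (Some c)
    = all (fun i => xle (F i) (Some c)) r.
Proof.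
by elim: r => [|i r IH]; rewrite ?big_nil //= big_cons xle_max IH.
Qed.

Lemma xmax_big_attained (I : eqType) (r : seq I) (F : I -> option Gamma) d :
    \big[@xmax Gamma/None]_(i <- r) F i = Some d ->
  exists2 i, i \in r & F i = Some d.
Proof.
elim: r => [|i r IH]; rewrite ?big_nil // big_cons /xmax.
case: ifP => _; last by move=> <-; exists i; rewrite ?mem_head.
by case/IH => j jr Fj; exists j; rewrite // inE jr orbT.
Qed.

Lemma xle_wdeg h c : xle (wdeg w h) (Some c) = wle h c.
Proof. by rewrite /wdeg xle_big. Qed.

(** Takes the default value 0 at h = 0; there [wle_fdeg] still holds, but [fdeg_le] may fail. *)
Definition fdeg h : Gamma := xfin (wdeg w h).

Lemma wdeg0 : wdeg w (0 : {mpoly k[n]}) = None.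
Proof. by rewrite /wdeg msupp0 big_nil. Qed.

Lemma wdeg_fdeg h : h != 0 -> wdeg w h = Some (fdeg h).
Proof.
rewrite /fdeg -msupp_eq0 /wdeg; case: (msupp h) => [|m s] // _.
case E: (\big[_/_]_(_ <- _) _) => [//|]; move: E; rewrite big_cons /xmax.
by case: (\big[_/_]_(_ <- _) _) => [b|] //; case: ifP.
Qed.

Lemma wle_fdeg h : wle h (fdeg h).
Proof.
have [->|nz] := eqVneq h 0; first exact: wle0.
by rewrite -xle_wdeg wdeg_fdeg //=.
Qed.

Lemma fdeg_le h c : h != 0 -> (fdeg h <= c) = wle h c.
Proof. by move=> nz; rewrite -xle_wdeg wdeg_fdeg. Qed.

Definition msel (Q : pred 'X_{1..n}) h : {mpoly k[n]} :=
  \sum_(m <- msupp h | Q m) h@_m *: 'X_[m].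

Lemma mcoeff_msel Q h m : (msel Q h)@_m = if Q m then h@_m else 0.
Proof.
rewrite /msel raddf_sum /= -big_filter.
have E m' : (h@_m' *: 'X_[m'])@_m = if m' == m then h@_m else 0.
  by rewrite mcoeffZ mcoeffX; case: eqP => [->|_]; rewrite ?mulr1 ?mulr0.
under eq_bigr do rewrite E.
rewrite -big_mkcond /=.
have [hm|hm] := boolP (m \in filter Q (msupp h)).
  rewrite -big_filter (@perm_big _ _ _ _ _ [:: m]) ?big_seq1 /=.
    by move: hm; rewrite mem_filter => /andP[->].
  rewrite (eq_filter (a2 := pred1 m)) //.
  by rewrite filter_pred1_uniq ?filter_uniq ?msupp_uniq.
rewrite big_seq_cond big_pred0 => [|m']; last first.
  by apply: contraNF hm => /andP[h' /eqP <-].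
move: hm; rewrite mem_filter mcoeff_msupp negb_and negbK.
by case: (Q m) => //= /eqP.
Qed.

Definition wcomp c := msel (fun m => wt m == c).

Lemma mcoeff_wcomp c h m : (wcomp c h)@_m = if wt m == c then h@_m else 0.
Proof. exact: mcoeff_msel. Qed.

Lemma wcompD c : {morph wcomp c : f g / f + g}.
Proof.
move=> f g; apply/mpolyP => m; rewrite mcoeffD !mcoeff_wcomp mcoeffD.
by case: ifP; rewrite ?addr0.
Qed.

Lemma wcomp0 c : wcomp c 0 = 0.
Proof. by apply/mpolyP => m; rewrite mcoeff_wcomp mcoeff0 if_same. Qed.

Lemma wcomp_sum (I : Type) (r : seq I) (P : pred I) (F : I -> {mpoly k[n]}) c :
  wcomp c (\sum_(i <- r | P i) F i) = \sum_(i <- r | P i) wcomp c (F i).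
Proof. exact: (big_morph _ (wcompD c) (wcomp0 c)). Qed.

Lemma wcomp_neq0_le c h d : wle h d -> wcomp c h != 0 -> c <= d.
Proof.
move=> /wleP hd; rewrite -msupp_eq0; case E: (msupp _) => [|m s] // _.
have: m \in msupp (wcomp c h) by rewrite E mem_head.
rewrite mcoeff_msupp mcoeff_wcomp; case: (_ =P c) => [<-|_]; last by rewrite eqxx.
exact: hd.
Qed.

Lemma wcomp_fdeg_neq0 h : h != 0 -> wcomp (fdeg h) h != 0.
Proof.
move=> nz; have [m hm Em] := xmax_big_attained (wdeg_fdeg nz).
apply: contraTneq hm => /mpolyP /(_ m); rewrite mcoeff_wcomp mcoeff0.
by case: Em => ->; rewrite eqxx mcoeff_msupp => ->; rewrite eqxx.
Qed.

Lemma wcomp_mulX c m h : wcomp (wt m + c) ('X_[m] * h) = 'X_[m] * wcomp c h.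
Proof.
apply/mpolyP => m'; rewrite mcoeff_wcomp.
have [/mnm_lepP hm|hm] := boolP (m <= m')%MM.
  have -> : m' = (m + (m' - m))%MM by rewrite addmC submK //; apply/mnm_lepP.
  by rewrite ![_ 'X_[m] _]mulrC !mcoeffMX mcoeff_wcomp mweightD (inj_eq (addrI _)).
suff E q : ('X_[m] * q)@_m' = 0 :> k by rewrite !E if_same.
rewrite mulrC; apply/eqP; rewrite mcoeff_eq0 (perm_mem (msuppMX _ _)).
apply: contraNN hm => /mapP[m'' _ ->]; apply/mnm_lepP => i.
by rewrite mnmDE leq_addr.
Qed.

Lemma wcompZ c x h : wcomp c (x *: h) = x *: wcomp c h.
Proof.
apply/mpolyP => m; rewrite mcoeffZ !mcoeff_wcomp mcoeffZ.
by case: ifP; rewrite ?mulr0.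
Qed.

Lemma wcomp_gt c h d : wle h d -> d < c -> wcomp c h = 0.
Proof.
move=> hd dc; apply/eqP; apply: contraTT dc => /(wcomp_neq0_le hd) cd.
by rewrite lt_neqAle eq_le cd andbC; case: (d <= c).
Qed.

(** A monomial of f of weight below a contributes only weights below a + b; one of weight a shifts
    components by exactly a. *)
Lemma wcompM a b f g : wle f a -> wle g b ->
  wcomp (a + b) (f * g) = wcomp a f * wcomp b g.
Proof.
move=> fa gb; rewrite {1}[f]mpolyE big_distrl wcomp_sum /=.
rewrite /(wcomp a) /msel big_distrl /= [RHS]big_mkcond /=.
apply: eq_big_seq => m hm; rewrite -scalerAl wcompZ.
have := allP fa m hm; rewrite le_eqVlt; case: eqP => [<- _|_ /= ma].
  by rewrite wcomp_mulX scalerAl.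
have E : wle ('X_[m] * g) (wt m + b) by apply: wleM gb; apply: wleX.
by rewrite (wcomp_gt E) ?scaler0 // oglt_le_add.
Qed.

(** The top components of f and h are nonzero, hence so is their product in the domain k[x]; by
    [wcompM] the leading weight cannot cancel. *)
Lemma wle_mull_inv f h c : f != 0 -> wle (f * h) (fdeg f + c) -> wle h c.
Proof.
move=> f0; have [-> _|h0] := eqVneq h 0; first exact: wle0.
move=> H; rewrite -fdeg_le // -(ogleD2l (fdeg f)).
apply: (wcomp_neq0_le H).
by rewrite wcompM ?wle_fdeg // mulf_neq0 ?wcomp_fdeg_neq0.
Qed.

Lemma fdegM f g : f != 0 -> g != 0 -> fdeg (f * g) = fdeg f + fdeg g.
Proof.
move=> f0 g0; have fg0 : f * g != 0 by rewrite mulf_neq0.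
apply: le_anti; rewrite fdeg_le // wleM ?wle_fdeg //=.
apply: (wcomp_neq0_le (wle_fdeg _)).
by rewrite wcompM ?wle_fdeg // mulf_neq0 ?wcomp_fdeg_neq0.
Qed.

Lemma fdeg1 : fdeg 1 = 0.
Proof.
by apply: (addrI (fdeg 1)); rewrite -fdegM ?oner_neq0 // mulr1 addr0.
Qed.

Lemma winitE f : winit w f = wcomp (fdeg f) f.
Proof.
have [->|f0] := eqVneq f 0; first by rewrite wcomp0 /winit msupp0 big_nil.
by apply: eq_bigl => m; rewrite wdeg_fdeg.
Qed.

End WeightBound.

(** * Exterior products of differentials *)

(** The pairs with j < i cancel those with i < j. The diagonal is left out of the sum, so
    characteristic 2 is covered. *)
Lemma sum_antisym (R : pzRingType) (n : nat) (G : 'I_n -> 'I_n -> R) :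
    (forall i j, i != j -> G i j = - G j i) ->
  \sum_i \sum_(j | j != i) G i j = 0.
Proof.
move=> anti.
have E i : \sum_(j | j != i) G i j =
    \sum_(j : 'I_n | (j < i)%N) G i j + \sum_(j : 'I_n | (i < j)%N) G i j.
  rewrite (bigID (fun j : 'I_n => (j < i)%N)) /=.
  by congr (_ + _); apply: eq_bigl => j; rewrite -val_eqE /=; case: ltngtP.
under eq_bigr do rewrite E.
rewrite big_split /= [X in _ + X](exchange_big_dep xpredT) //= -big_split big1 //.
move=> i _; rewrite -big_split big1 //= => j ji.
by rewrite anti ?addNr // -val_eqE /= gtn_eqF.
Qed.

Lemma mderivXU (R : nzRingType) (n : nat) (i j : 'I_n) :
  ('X_i : {mpoly R[n]})^`M(j) = (i == j)%:R.
Proof.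
rewrite mderivX mnm1E; case: eqP => [->|_]; last by rewrite scale0r.
by rewrite -[X in (X - _)%MM]add0m addmK mpolyX0 scale1r.
Qed.

Section Forms.
Variables (k : fieldType) (n : nat).
Local Notation R := {mpoly k[n]}.
Local Notation form := {ffun {set 'I_n} -> R}.
Implicit Types (h : R) (omega : form) (K : {set 'I_n}) (i j : 'I_n).

(** For i in K, the exponent of the sign relating dx_i /\ dx_(K :\ i) to dx_K. *)
Definition below i K : nat := #|[set a in K | (a < i)%N]|.

Lemma wedge_diffl h omega K :
  wedge (diff h) omega K =
    \sum_(i in K) (-1) ^+ below i K * (h^`M(i) * omega (K :\ i)).
Proof.
rewrite ffunE.
transitivity (\sum_(I : {set 'I_n} | I \subset K) \sum_(i | I == [set i])
   (-1) ^+ below i K * (h^`M(i) * omega (K :\ i))).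
  apply: eq_bigr => I _; rewrite ffunE mulr_suml mulr_sumr.
  apply: eq_bigr => i /eqP ->; congr ((-1) ^+ _ * _).
  rewrite /inversions /below.
  rewrite -[RHS](@card_imset _ _ (pair i)) => [|a b [] //].
  apply: eq_card => -[a b]; rewrite !inE /=.
  apply/idP/imsetP => [/and3P[/eqP -> /andP[_ bK] bi]|[c]].
    by exists b; rewrite // inE bK.
  by rewrite inE => /andP[cK ci] [-> ->]; rewrite eqxx cK ci -val_eqE /= ltn_eqF.
rewrite (exchange_big_dep xpredT) //= [RHS]big_mkcond /=.
apply: eq_bigr => i _.
case: ifP => iK; last first.
  rewrite big_pred0 // => I; apply: contraFF iK => /andP[/subsetP sI /eqP E].
  by apply: sI; rewrite E set11.
rewrite (big_pred1 [set i]) // => I.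
by rewrite /=; case: eqP => [->|//]; rewrite ?andbF // andbT sub1set.
Qed.

(** Moving dh to the front passes |K| - 1 one-forms: the elements of K smaller than i count on the
    left, the larger ones on the right, and together they make |K| - 1. *)
Lemma wedge_diffr h omega K :
  wedge omega (diff h) K = (-1) ^+ #|K|.-1 * wedge (diff h) omega K.
Proof.
rewrite wedge_diffl ffunE.
transitivity (\sum_(I : {set 'I_n} | I \subset K) \sum_(i | K :\: I == [set i])
   (-1) ^+ #|K|.-1 * ((-1) ^+ below i K * (h^`M(i) * omega (K :\ i)))).
  apply: eq_bigr => I sI; rewrite ffunE mulr_sumr mulr_sumr.
  apply: eq_bigr => i /eqP E.
  have EI : I = K :\ i by rewrite -E setDDr setDv set0U; apply/esym/setIidPr.
  have iK : i \in K by have := set11 i; rewrite -E inE => /andP[].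
  rewrite mulrA -exprD [omega _ * _]mulrC E EI -signr_odd -[in RHS]signr_odd.
  congr (_ ^+ _ * _); congr (nat_of_bool _).
  rewrite (cardsD1 i) iK /= add0n.
  have -> : inversions (K :\ i) [set i] = #|[set a in K | (i < a)%N]|.
    rewrite /inversions -[RHS](@card_imset _ _ (pair^~ i)) => [|a b [] //].
    apply: eq_card => -[a b]; rewrite !inE /=.
    apply/idP/imsetP => [/and3P[/andP[_ aK] /eqP -> ai]|[c]].
      by exists a; rewrite // inE aK.
    by rewrite inE => /andP[cK ci] [-> ->]; rewrite eqxx cK ci -val_eqE /= gtn_eqF.
  have -> : #|K :\ i| = (below i K + #|[set a in K | (i < a)%N]|)%N.
    rewrite -cardsUI [X in (_ + X)%N](_ : _ = 0%N) ?addn0.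
      apply: eq_card => a; rewrite !inE -val_eqE /=.
      by case: ltngtP; case: (a \in K).
    apply/eqP; rewrite cards_eq0; apply/eqP/setP => a; rewrite !inE.
    by case: ltngtP; rewrite ?andbF.
  by rewrite !oddD addbAC addbb.
rewrite (exchange_big_dep xpredT) //= mulr_sumr [RHS]big_mkcond /=.
apply: eq_bigr => i _.
case: ifP => iK; last first.
  rewrite big_pred0 // => I; apply: contraFF iK => /andP[_ /eqP E].
  by have := set11 i; rewrite -E inE => /andP[].
rewrite (big_pred1 (K :\ i)) // => I /=.
apply/andP/eqP => [[sI /eqP E]|->].
  by rewrite -E setDDr setDv set0U; apply/esym/setIidPr.
rewrite subsetDl; split=> //; rewrite setDDr setDv set0U.
by apply/eqP/setIidPr; rewrite sub1set.
Qed.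

Lemma below_setD1 i j K : i \in K -> i != j ->
  below j (K :\ i) = (below j K - (i < j))%N.
Proof.
move=> iK ij; rewrite /below [in RHS](cardsD1 i) inE iK /= addKn.
by apply: eq_card => a; rewrite !inE andbA.
Qed.

Lemma below_gt0 i j K : i \in K -> (i < j)%N -> (0 < below j K)%N.
Proof. by move=> iK ij; apply/card_gt0P; exists i; rewrite inE iK. Qed.

(** Separates a factor antisymmetric in i and j ([wedge_sign_antisym]) from the product of partial
    derivatives. *)
Lemma wedge_diff2 (a b : R) omega K :
  wedge (diff a) (wedge (diff b) omega) K =
    \sum_i \sum_(j | j != i)
      (if (i \in K) && (j \in K) then
        (-1) ^+ (below i K + below j (K :\ i)) * omega (K :\ i :\ j) else 0)
       * (a^`M(i) * b^`M(j)).
Proof.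
rewrite wedge_diffl big_mkcond /=; apply: eq_bigr => i _.
case: ifP => iK /=; last by rewrite big1 // => j _; rewrite mul0r.
rewrite wedge_diffl !mulr_sumr [LHS]big_mkcond [RHS]big_mkcond /=.
apply: eq_bigr => j _; rewrite !inE; case: eqP => //= _.
case: ifP => _; last by rewrite mul0r.
rewrite exprD; move: ((-1) ^+ _) ((-1) ^+ _) => s1 s2; ring.
Qed.

(** Removing the smaller of i and j lowers the count below the larger by one, while removing the
    larger changes nothing below the smaller; so exchanging them flips the sign. *)
Lemma wedge_sign_antisym omega K i j : i != j ->
  let T i j := (if (i \in K) && (j \in K) then
        (-1) ^+ (below i K + below j (K :\ i)) * omega (K :\ i :\ j) else 0) in
  T i j = - T j i.
Proof.
move=> ij /=; rewrite [(j \in K) && _]andbC.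
case: ifP => [/andP[iK jK]|_]; last by rewrite oppr0.
have -> : K :\ j :\ i = K :\ i :\ j by apply/setP => a; rewrite !inE andbCA.
rewrite -mulNr; congr (_ * _); rewrite !below_setD1 // 1?eq_sym //.
wlog lt_ij : i j ij iK jK / (i < j)%N => [W|].
  have := ij; rewrite -val_eqE /= neq_ltn => /orP[|] lt_ij; first exact: W.
  by rewrite (W j i) // ?opprK // eq_sym.
rewrite lt_ij ltnNge ltnW //= subn0.
have := below_gt0 iK lt_ij; case: (below j K) => // b _.
by rewrite subn1 /= addSn exprS mulN1r opprK addnC.
Qed.

Lemma wedge_diff_sqr h omega : wedge (diff h) (wedge (diff h) omega) = 0.
Proof.
apply/ffunP => K; rewrite wedge_diff2 ffunE; apply: sum_antisym => i j ij.
by rewrite wedge_sign_antisym // mulNr [h^`M(j) * _]mulrC.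
Qed.

Lemma wedge_diff_anti (a b : R) omega :
  wedge (diff a) (wedge (diff b) omega) = - wedge (diff b) (wedge (diff a) omega).
Proof.
apply/ffunP => K; rewrite [RHS]ffunE; apply/eqP; rewrite -addr_eq0 !wedge_diff2.
rewrite -big_split /=; under eq_bigr do rewrite -big_split /=.
apply/eqP; apply: sum_antisym => i j ij.
rewrite wedge_sign_antisym // !mulNr -opprD; congr (- _).
by rewrite -!mulrDr; congr (_ * _); rewrite addrC; congr (_ + _); rewrite mulrC.
Qed.

Lemma wedge_0r (omega : form) : wedge omega 0 = 0.
Proof. by apply/ffunP => K; rewrite !ffunE big1 // => I _; rewrite ffunE !mulr0. Qed.

(** Products are nested to the right, so facts about them follow by induction on s from the left
    expansion [wedge_diffl]. *)
Definition dwedge (s : seq R) : form := \big[@wedge k n/form1 k n]_(h <- s) diff h.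

Lemma dwedge_cons h s : dwedge (h :: s) = wedge (diff h) (dwedge s).
Proof. exact: big_cons. Qed.

Lemma diff_tupleE r (f : r.-tuple R) : diff_tuple f = dwedge f.
Proof. by rewrite /dwedge big_tuple. Qed.

Lemma dwedge_mem h s : h \in s -> wedge (diff h) (dwedge s) = 0.
Proof.
elim: s => [//|a s IH]; rewrite inE dwedge_cons => /orP[/eqP <-|/IH E].
  exact: wedge_diff_sqr.
by rewrite wedge_diff_anti E wedge_0r oppr0.
Qed.

Lemma dwedge_uniq s : ~~ uniq s -> dwedge s = 0.
Proof.
elim: s => [//|a s IH] /=; rewrite dwedge_cons negb_and negbK => /orP[].
  exact: dwedge_mem.
by move/IH ->; apply: wedge_0r.
Qed.

(** The factor dx_j occurs in the product, so it occurs in every dx_K with nonzero coefficient. *)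
Lemma dwedge_var j s K : 'X_j \in s -> j \notin K -> dwedge s K = 0.
Proof.
elim: s K => [//|a s IH] K.
rewrite inE dwedge_cons wedge_diffl => /orP[/eqP <-|xs] jK.
  rewrite big1 // => i iK; rewrite mderivXU.
  by case: eqP iK jK => [-> ->|] //; rewrite !(mul0r, mulr0).
rewrite big1 // => i iK; rewrite IH ?mulr0 //.
by rewrite !inE negb_and jK orbT.
Qed.

Lemma dwedge_card s K : dwedge s K != 0 -> #|K| = size s.
Proof.
elim: s K => [|a s IH] K.
  rewrite /dwedge big_nil ffunE; case: (K =P _) => [-> _|]; last by rewrite eqxx.
  by rewrite cards0.
rewrite dwedge_cons wedge_diffl => nz.
have [i /andP[iK ni]] : exists i, (i \in K) && (dwedge s (K :\ i) != 0).
  apply/existsP; apply: contraNT nz; rewrite negb_exists => /forallP H.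
  rewrite big1 // => i iK; have := H i; rewrite iK negbK => /eqP ->.
  by rewrite !mulr0.
by rewrite (cardsD1 i) iK (IH _ ni).
Qed.

(** Each factor dh contributes a derivative by some x_i, which lowers the degree by w_i. Applied to
    z this yields [Lambda1] >= 0. *)
Lemma dwedge_wle (Gamma : orderedQVectType) (w : 'I_n -> Gamma) s K :
  wle w (dwedge s K) (\sum_(h <- s) fdeg w h - \sum_(i in K) w i).
Proof.
elim: s K => [|a s IH] K.
  rewrite /dwedge !big_nil ffunE; case: eqP => [->|_]; last exact: wle0.
  by rewrite big_set0 subr0 -mpolyC1; apply: wleC.
rewrite dwedge_cons wedge_diffl; apply: wle_sum => i iK; apply: wle_signM.
rewrite big_cons (big_setD1 i iK) /= opprD addrACA.
by apply: wleM (IH _); apply/wle_deriv/wle_fdeg.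
Qed.

End Forms.

(** For dimensions that are equal only propositionally, later [size z] and [#|I|]. *)
Lemma mulmx1_sq (K : comUnitRingType) (s t : nat)
    (A : 'M[K]_(s, t)) (B : 'M_(t, s)) :
  s = t -> A *m B = 1%:M -> B *m A = 1%:M.
Proof. by move=> E; case: t / E A B => A B; apply: mulmx1C. Qed.

(** * Power series modulo ['X^N] *)

Section Truncation.
Variable K : fieldType.
Implicit Types (p q c : {poly K}) (N : nat).

Definition eqX N p q := forall i, (i < N)%N -> p`_i = q`_i.

Lemma eqX_sym N p q : eqX N p q -> eqX N q p.
Proof. by move=> H i iN; rewrite H. Qed.

Lemma eqX_trans N p q c : eqX N p q -> eqX N q c -> eqX N p c.
Proof. by move=> H H' i iN; rewrite H ?H'. Qed.

Lemma eqXD N p q p' q' : eqX N p q -> eqX N p' q' -> eqX N (p + p') (q + q').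
Proof. by move=> H H' i iN; rewrite !coefD H ?H'. Qed.

Lemma eqXM N p q p' q' : eqX N p q -> eqX N p' q' -> eqX N (p * p') (q * q').
Proof.
move=> H H' i iN; rewrite !coefM; apply: eq_bigr => j _.
by rewrite H ?H' // (leq_ltn_trans _ iN) // ?leq_subr // -ltnS.
Qed.

Lemma eqX_addX N p q : eqX N (p + 'X^N * q) p.
Proof. by move=> i iN; rewrite coefD coefXnM iN addr0. Qed.

(* Inverse of [c] modulo ['X^N], as a truncated geometric series. *)
Definition trinv N c : {poly K} :=
  (c`_0)^-1 *: \sum_(i < N) (1 - (c`_0)^-1 *: c) ^+ i.

Lemma trinvP N c : c`_0 != 0 -> eqX N (c * trinv N c) 1.
Proof.
move=> c0; set y := 1 - (c`_0)^-1 *: c.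
have [q Ey] : exists q, y = 'X * q.
  have : y %% 'X = 0.
    by rewrite -['X]subr0 -polyC0 modp_XsubC /y !hornerE horner_coef0 mulVf // subrr.
  by move/modp_eq0P/dvdpP => [q ->]; exists q; rewrite mulrC.
have -> : c * trinv N c = 1 + 'X^N * - q ^+ N.
  rewrite /trinv -/y -scalerAr scalerAl.
  have -> : (c`_0)^-1 *: c = 1 - y by rewrite /y opprB addrC subrK.
  by rewrite -opprB mulNr -subrX1 opprB Ey exprMn mulrN.
exact: eqX_addX.
Qed.

Lemma eqX_mulIr N p q c : c`_0 != 0 -> eqX N (p * c) (q * c) -> eqX N p q.
Proof.
move=> c0 /(eqXM (fun i _ => erefl (trinv N c)`_i)) H.
have E r : eqX N (trinv N c * (r * c)) r.
  rewrite (_ : _ * _ = r * (c * trinv N c)); last by ring.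
  rewrite -[X in eqX _ _ X]mulr1; apply: eqXM => //; exact: trinvP.
exact: eqX_trans (eqX_sym (E p)) (eqX_trans H (E q)).
Qed.

End Truncation.

(** The terms are grouped by m = a + b, and the coefficient of F m is a Vandermonde convolution. It
    matches the two Leibniz expansions in [hs_iter]. *)
Lemma vandermonde_box (V : pzRingType) (i j : nat) (F : nat -> V) :
  \sum_(a < i.+1) \sum_(b < j.+1)
     F (a + b)%N *+ ('C(a + b, a) * 'C(i - a + (j - b), i - a))
  = \sum_(m < (i + j).+1) F m *+ 'C(i + j, i).
Proof.
transitivity (\sum_(a < i.+1) \sum_(m < (i + j).+1)
    F m *+ ('C(m, a) * 'C(i + j - m, i - a))).
  apply: eq_bigr => a _; have ai : (a <= i)%N by rewrite -ltnS.
  pose G m := F m *+ ('C(m, a) * 'C(i + j - m, i - a)).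
  (* Only a <= m <= a + j matters: outside this range one of the two binomials is zero. *)
  rewrite -(big_mkord xpredT G) (@big_cat_nat _ _ _ a) //=; last first.
    by rewrite ltnW // ltnS (leq_trans ai) ?leq_addr.
  have -> : \sum_(0 <= m < a) G m = 0.
    rewrite big_nat; apply: big1 => m /andP[_ ma].
    by rewrite /G bin_small // mul0n mulr0n.
  rewrite add0r (@big_cat_nat _ _ _ (a + j).+1) /= ?ltnS ?leq_add2r //; last first.
    by rewrite ltnW // ltnS leq_addr.
  have -> : \sum_((a + j).+1 <= m < (i + j).+1) G m = 0.
    rewrite big_nat; apply: big1 => m /andP[jm mn].
    by rewrite /G ['C(i + j - m, _)]bin_small ?muln0 ?mulr0n //; lia.
  rewrite addr0.
  rewrite -[X in \sum_(X <= _ < _) _]add0n big_addn -addnS addKn.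
  rewrite big_mkord; apply: eq_bigr => b _; have bj : (b <= j)%N by rewrite -ltnS.
  by rewrite /G addnC; congr (_ *+ (_ * 'C(_, _))); lia.
rewrite exchange_big; apply: eq_bigr => m _ /=; rewrite sumrMnr; congr (_ *+ _).
by rewrite binomial.Vandermonde subnKC // -ltnS.
Qed.

Lemma mnm_closure (n : nat) (Q : 'X_{1..n} -> Prop) :
    Q 0%MM -> (forall i, Q U_(i)%MM) ->
    (forall m m', Q m -> Q m' -> Q (m + m')%MM) ->
  forall m, Q m.
Proof.
move=> Q0 QU QD m; rewrite (multinomUE_id m); apply: (big_ind Q) => // i _.
elim: (m i) => [|j IH]; first by rewrite mulm0n.
by rewrite mulmS; apply: (QD).
Qed.

(** Recovers the cofactor at a root of multiplicity m: evaluated at a, the product rule for one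
    factor ['X - a%:P] lowers m by one. *)
Lemma nderivn_mulX (R : comNzRingType) (q : {poly R}) (a : R) m :
  (q * ('X - a%:P)^+ m)^`N(m).[a] = q.[a].
Proof.
elim: m q => [|m IH] q; first by rewrite expr0 mulr1 nderivn0.
rewrite exprSr mulrA -[RHS]IH; set p := q * _.
have -> : p * ('X - a%:P) = p * 'X + 0%:P - a *: p.
  by rewrite addr0 mulrBr [p * _%:P]mulrC mul_polyC.
rewrite nderivnB nderivnMXaddC nderivnZ !hornerE.
by rewrite mulrC addrK.
Qed.

(** The bound s is free so that P and its initial form, whose sizes may differ, expand over the same
    range. *)
Lemma nderivn_horner (R : comNzRingType) (P : {poly R}) m s x : (size P <= s)%N ->
  P^`N(m).[x] = \sum_(j < s) (P`_j * x ^+ (j - m)) *+ 'C(j, m).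
Proof.
move=> sP; rewrite -{1}[P]coefK poly_def (big_morph _ (nderivnD m) (raddf0 _)).
rewrite horner_sum /=.
rewrite -(big_mkord xpredT (fun j => (P`_j *: 'X^j)^`N(m).[x])).
rewrite -(big_mkord xpredT (fun j => (P`_j * x ^+ (j - m)) *+ 'C(j, m))).
rewrite [RHS](big_cat_nat (n := size P)) //= [X in _ = _ + X]big_nat.
rewrite [X in _ = _ + X]big1 ?addr0 => [|j /andP[sj _]]; last first.
  by rewrite nth_default // mul0r mul0rn.
apply: eq_bigr => j _.
by rewrite nderivnZ nderivnXn hornerZ hornerMn hornerXn mulrnAr.
Qed.

(** * Degrees of differential forms and of powers *)

Section FormDegree.
Variables (Gamma : orderedQVectType) (k : fieldType) (n : nat).
Variable w : 'I_n -> Gamma.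

Lemma xle_maxl (a b : option Gamma) : xle a (xmax a b).
Proof. by rewrite /xmax; case: ifP => //; case: a => //= a; rewrite lexx. Qed.

Lemma xle_maxr (a b : option Gamma) : xle b (xmax a b).
Proof.
rewrite /xmax; case: ifP => [_|]; first by case: b => //= b; apply: lexx.
case: a b => [a|] [b|] //= H; by have := ogle_total a b; rewrite H.
Qed.

Lemma xle_big_mem (T : eqType) (s : seq T) (F : T -> option Gamma) i :
  i \in s -> xle (F i) (\big[@xmax Gamma/None]_(j <- s) F j).
Proof.
elim: s => [//|j s IH]; rewrite inE big_cons => /orP[/eqP ->|/IH H].
  exact: xle_maxl.
exact: xle_trans H (xle_maxr _ _).
Qed.

Lemma wdeg_form_wle (omega : {ffun {set 'I_n} -> {mpoly k[n]}}) K :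
  wle w (omega K) (xfin (wdeg_form w omega) - \sum_(i in K) w i).
Proof.
have [->|nz] := eqVneq (omega K) 0; first exact: wle0.
have : xle (Some (fdeg w (omega K) + \sum_(i in K) w i)) (wdeg_form w omega).
  apply: xle_trans (xle_big_mem _ (mem_index_enum K)).
  by rewrite wdeg_fdeg //= lexx.
case: (wdeg_form w omega) => [d|] //= H.
by rewrite -fdeg_le // ogle_subr.
Qed.

Lemma wdeg_form_attained (omega : {ffun {set 'I_n} -> {mpoly k[n]}}) : omega != 0 ->
  exists2 I, omega I != 0 &
    xfin (wdeg_form w omega) = fdeg w (omega I) + \sum_(i in I) w i.
Proof.
move=> nz; have [K nzK] : exists K, omega K != 0.
  apply/existsP; apply: contraNT nz; rewrite negb_exists => /forallP H.
  by apply/eqP/ffunP => K; rewrite ffunE; apply/eqP; rewrite -[_ == _]negbK.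
have : xle (Some (fdeg w (omega K) + \sum_(i in K) w i)) (wdeg_form w omega).
  apply: xle_trans (xle_big_mem _ (mem_index_enum K)).
  by rewrite wdeg_fdeg //= lexx.
case E: (wdeg_form w omega) => [d|] // _.
have [I _] := xmax_big_attained E; have [->|nzI] := eqVneq (omega I) 0.
  by rewrite wdeg0.
by rewrite wdeg_fdeg //= => -[<-]; exists I.
Qed.

Lemma wle_wedge_diff (h : {mpoly k[n]})
    (omega : {ffun {set 'I_n} -> {mpoly k[n]}}) K :
  wle w (wedge (diff h) omega K)
    (fdeg w h + xfin (wdeg_form w omega) - \sum_(i in K) w i).
Proof.
rewrite wedge_diffl; apply: wle_sum => i iK; apply: wle_signM.
rewrite (big_setD1 i iK) /= opprD addrACA.
by apply: wleM (wdeg_form_wle _ _); apply/wle_deriv/wle_fdeg.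
Qed.

Lemma fdegN (h : {mpoly k[n]}) : fdeg w (- h) = fdeg w h.
Proof.
have [->|nz] := eqVneq h 0; first by rewrite oppr0.
have nz' : - h != 0 by rewrite oppr_eq0.
apply: le_anti; rewrite !fdeg_le // wleN ?wle_fdeg //=.
by rewrite -[h]opprK wleN ?opprK ?wle_fdeg.
Qed.

Lemma fdeg_signM s (h : {mpoly k[n]}) : fdeg w ((-1) ^+ s * h) = fdeg w h.
Proof. by rewrite -signr_odd mulr_sign; case: (odd s); rewrite ?fdegN. Qed.

Lemma wleXn (h : {mpoly k[n]}) c e : wle w h c -> wle w (h ^+ e) (c *+ e).
Proof.
move=> hc; elim: e => [|e IH]; first by rewrite expr0 mulr0n -mpolyC1 wleC.
by rewrite exprS mulrS; apply: wleM.
Qed.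

Lemma wcompXn (h : {mpoly k[n]}) c e : wle w h c ->
  wcomp w (c *+ e) (h ^+ e) = wcomp w c h ^+ e.
Proof.
move=> hc; elim: e => [|e IH]; last by rewrite !exprS mulrS wcompM ?IH // wleXn.
apply/mpolyP => m; rewrite !expr0 mulr0n mcoeff_wcomp mcoeff1.
by case: (m =P _) => [->|_]; rewrite ?mweight0 ?eqxx // if_same.
Qed.

Lemma wcompMn (h : {mpoly k[n]}) c e : wcomp w c (h *+ e) = wcomp w c h *+ e.
Proof. by elim: e => [|e IH]; rewrite ?mulr0n ?wcomp0 // !mulrS wcompD IH. Qed.

End FormDegree.

(** * Initial forms *)

Section InitialForm.
Variables (Gamma : orderedQVectType) (k : fieldType) (n : nat).
Variables (w : 'I_n -> Gamma) (g : {mpoly k[n]}) (P : {poly {mpoly k[n]}}).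
Hypothesis P0 : P != 0.
Let d := xfin (wdegT w (fdeg w g) P).

Lemma wdegT_fin : wdegT w (fdeg w g) P = Some d.
Proof.
rewrite /d; case E: (wdegT _ _ _) => [//|].
have [m hm] : exists m, m \in msupp (lead_coef P).
  have := msupp_eq0 (lead_coef P); rewrite lead_coef_eq0 (negPf P0).
  by case: (msupp _) => [|m s] // _; exists m; rewrite mem_head.
have sP : ((size P).-1 < size P)%N by rewrite prednK // size_poly_gt0.
have := xle_big_mem (fun i : 'I_(size P) => \big[@xmax Gamma/None]_(m <- msupp P`_i)
  Some (Defs.mweight w m + fdeg w g *+ i)) (mem_index_enum (Ordinal sP)).
rewrite -/(wdegT w (fdeg w g) P) E /=.
have := xle_big_mem (fun m => Some (Defs.mweight w m + fdeg w g *+ (size P).-1)) hm.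
by case: (\big[_/_]_(_ <- _) _).
Qed.

Lemma coef_wle i : wle w P`_i (d - fdeg w g *+ i).
Proof.
have [sP|sP] := ltnP i (size P); last by rewrite nth_default //; apply: wle0.
apply/allP => m hm; rewrite ogle_subr.
have H1 := xle_big_mem (fun i : 'I_(size P) =>
  \big[@xmax Gamma/None]_(m <- msupp P`_i)
     Some (Defs.mweight w m + fdeg w g *+ i)) (mem_index_enum (Ordinal sP)).
have H2 := xle_big_mem (fun m => Some (Defs.mweight w m + fdeg w g *+ i)) hm.
have := xle_trans H2 H1.
by rewrite -/(wdegT w (fdeg w g) P) wdegT_fin.
Qed.

Lemma coef_winitT i :
  (winitT w (fdeg w g) P)`_i = wcomp w (d - fdeg w g *+ i) P`_i.
Proof.
rewrite coef_poly; case: ltnP => [_|sP]; last by rewrite nth_default // wcomp0.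
apply: eq_bigl => m; rewrite wdegT_fin.
by apply/eqP/eqP => [[<-]|->]; rewrite ?addrK ?subrK.
Qed.

Lemma winitT_neq0 : winitT w (fdeg w g) P != 0.
Proof.
have [i _ Ei] := xmax_big_attained wdegT_fin.
have [m hm [Em]] := xmax_big_attained Ei.
apply: contraTneq hm => /polyP /(_ i) /mpolyP /(_ m).
rewrite coef_winitT coef0 mcoeff0 mcoeff_wcomp -Em addrK eqxx mcoeff_msupp => ->.
by rewrite eqxx.
Qed.

(** For m <= j the summand P_j g^(j - m) has weight at most d - m deg g, and its component in that
    weight is the product of the components of its factors. *)
Lemma wcomp_nderivn m :
  wcomp w (d - fdeg w g *+ m) P^`N(m).[g] =
    (winitT w (fdeg w g) P)^`N(m).[winit w g].
Proof.
rewrite (nderivn_horner _ _ (leqnn _)) (nderivn_horner _ _ (size_poly _ _)).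
rewrite wcomp_sum; apply: eq_bigr => j _; rewrite wcompMn coef_winitT winitE.
have [mj|jm] := leqP m j; last by rewrite bin_small // !mulr0n.
have -> : d - fdeg w g *+ m = (d - fdeg w g *+ j) + fdeg w g *+ (j - m).
  by rewrite mulrnBr // addrA subrK.
by rewrite wcompM ?wcompXn ?wleXn ?wle_fdeg //; apply: coef_wle.
Qed.

(** Writing the initial form of P as q (T - g^w)^m, [nderivn_mulX] leaves q(g^w), which is
    nonzero. *)
Lemma wcomp_nderivn_init_mult :
  wcomp w (d - fdeg w g *+ init_mult w g P) P^`N(init_mult w g P).[g] != 0.
Proof.
rewrite wcomp_nderivn /init_mult /root_mult -/(fdeg w g).
case: multiplicity_XsubC => m0 /= [q]; rewrite winitT_neq0 /= => nq E.
by rewrite {1}E nderivn_mulX.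
Qed.

End InitialForm.

(** * Degrees and derivations on the field of fractions *)

Section FractionField.
(* [K] stands for [{fraction {mpoly k[n]}}]. *)
Variables (k : fieldType) (n : nat) (K : fieldType).
Variable iota : {rmorphism {mpoly k[n]} -> K}.
Local Notation R := {mpoly k[n]}.
Local Notation "x %:F" := (iota x).
Hypothesis iota_inj : injective iota.
Hypothesis iota_frac : forall u, exists a b : R, b != 0 /\ u = a%:F / b%:F.

Let iotaD (a b : R) : (a + b)%:F = a%:F + b%:F. Proof. exact: rmorphD. Qed.
Let iotaN (a : R) : (- a)%:F = - a%:F. Proof. exact: rmorphN. Qed.
Let iotaM (a b : R) : (a * b)%:F = a%:F * b%:F. Proof. exact: rmorphM. Qed.
Let iota0 : 0%:F = 0. Proof. exact: rmorph0. Qed.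
Let iota1 : 1%:F = 1. Proof. exact: rmorph1. Qed.
Let iota_eq0 (a : R) : (a%:F == 0) = (a == 0). Proof. by rewrite raddf_eq0. Qed.

Section FractionDegree.
Variables (Gamma : orderedQVectType) (w : 'I_n -> Gamma).
Implicit Types (c d : Gamma).
Local Notation fdeg := (@fdeg Gamma k n w).
Local Notation wle := (@wle Gamma k n w).

(** The degree of a / b is deg a - deg b. One representation suffices, since degrees are additive on
    products. *)
Definition fle (u : K) c :=
  exists a b : {mpoly k[n]}, [/\ b != 0, u = a%:F / b%:F & wle a (c + fdeg b)].

Lemma fle_iota h c : fle h%:F c -> wle h c.
Proof.
case=> a [b [b0 E H]]; apply: (wle_mull_inv b0).
suff <- : a = b * h by rewrite addrC.
by apply: iota_inj; rewrite iotaM E mulrC divfK ?iota_eq0.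
Qed.

Lemma wle_iota h c : wle h c -> fle h%:F c.
Proof.
move=> H; exists h, 1; split; rewrite ?oner_neq0 // ?iota1 ?divr1 //.
by rewrite fdeg1 addr0.
Qed.

Lemma fle_div u (b : R) c :
  b != 0 -> fle u c -> fle (u / b%:F) (c - fdeg b).
Proof.
move=> b0 [a [b' [b'0 -> H]]]; exists a, (b' * b); split.
- by rewrite mulf_neq0.
- by rewrite iotaM invfM mulrA.
- by rewrite fdegM // addrCA addrNK addrC.
Qed.

Lemma fleM u v c d : fle u c -> fle v d -> fle (u * v) (c + d).
Proof.
move=> [a [b [b0 -> H]]] [a' [b' [b'0 -> H']]]; exists (a * a'), (b * b'); split.
- by rewrite mulf_neq0.
- by rewrite !iotaM invfM mulrACA.
- by rewrite fdegM // addrACA; apply: wleM.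
Qed.

Lemma fleD u v c : fle u c -> fle v c -> fle (u + v) c.
Proof.
move=> [a [b [b0 -> H]]] [a' [b' [b'0 -> H']]].
exists (a * b' + a' * b), (b * b'); split.
- by rewrite mulf_neq0.
- by rewrite iotaD !iotaM addf_div ?iota_eq0.
- rewrite fdegM // addrA; apply: wleD.
    by apply: wleM => //; apply: wle_fdeg.
  by rewrite addrAC; apply: wleM => //; apply: wle_fdeg.
Qed.

Lemma fle_trans u c d : fle u c -> c <= d -> fle u d.
Proof.
move=> [a [b [b0 -> H]]] cd; exists a, b; split=> //.
by apply: wle_trans H _; rewrite ogleD2r.
Qed.

Lemma fle0 c : fle 0 c.
Proof. by rewrite -iota0; apply/wle_iota/wle0. Qed.

Lemma fleN u c : fle u c -> fle (- u) c.
Proof.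
move=> [a [b [b0 -> H]]]; exists (- a), b; split=> //; last exact: wleN.
by rewrite iotaN mulNr.
Qed.

Lemma fle_sum (I : Type) (r : seq I) (P : pred I) (F : I -> K) c :
  (forall i, P i -> fle (F i) c) -> fle (\sum_(i <- r | P i) F i) c.
Proof.
move=> H; apply: (big_ind (fle ^~ c)) => //; first exact: fle0.
by move=> *; apply: fleD.
Qed.

End FractionDegree.

(** * Derivations of k[x] over k with values in K *)

Definition is_der (delta : R -> K) : Prop :=
  [/\ {morph delta : a b / a + b},
      forall a b, delta (a * b) = a%:F * delta b + b%:F * delta a
    & forall c : k, delta c%:MP = 0].

Lemma is_der_ext (d1 d2 : R -> K) : is_der d1 -> is_der d2 ->
  (forall i, d1 'X_i = d2 'X_i) -> d1 =1 d2.
Proof.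
move=> [A1 M1 C1] [A2 M2 C2] X; apply: mpoly_closure => [c|//|p q P Q|p q P Q].
- by rewrite C1 C2.
- by rewrite A1 A2 P Q.
- by rewrite M1 M2 P Q.
Qed.

Lemma is_der_sum (I : Type) (r : seq I) (P : pred I) (c : I -> K)
    (d : I -> R -> K) :
  (forall t, P t -> is_der (d t)) ->
  is_der (fun h => \sum_(t <- r | P t) c t * d t h).
Proof.
move=> H; split => [a b|a b|x].
- rewrite -big_split; apply: eq_bigr => t /H[A _ _] /=.
  by rewrite A mulrDr.
- rewrite !mulr_sumr -big_split; apply: eq_bigr => t /H[_ M _] /=.
  by rewrite M mulrDr; congr (_ + _); rewrite mulrCA.
- by rewrite big1 // => t /H[_ _ ->]; rewrite mulr0.
Qed.

Lemma is_der_scale c d : is_der d -> is_der (fun h => c * d h).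
Proof.
case=> A M C; split => [a b|a b|x]; rewrite ?A ?M ?C ?mulr0 ?mulrDr //.
by congr (_ + _); rewrite mulrCA.
Qed.

Lemma is_der_sub d1 d2 : is_der d1 -> is_der d2 -> is_der (fun h => d1 h - d2 h).
Proof.
move=> [A1 M1 C1] [A2 M2 C2]; split=> [a b|a b|c]; rewrite ?A1 ?A2 ?M1 ?M2.
- by rewrite opprD addrACA.
- by rewrite !mulrBr opprD addrACA.
- by rewrite C1 C2 subrr.
Qed.

Lemma is_der_partial i : is_der (fun h => h^`M(i)%:F).
Proof.
split=> [a b|a b|c]; first by rewrite mderivD iotaD.
  by rewrite mderivM iotaD !iotaM addrC [in X in _ + X]mulrC.
by rewrite mderivC iota0.
Qed.

Lemma sum_partialX (c : 'I_n -> K) j :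
  \sum_i c i * (('X_j)^`M(i))%:F = c j.
Proof.
rewrite (bigD1 j) //= big1 ?addr0 => [|i ij].
  by rewrite mderivXU eqxx iota1 mulr1.
by rewrite mderivXU eq_sym (negPf ij) iota0 mulr0.
Qed.

Lemma is_der_chain d : is_der d ->
  forall h, d h = \sum_i d 'X_i * h^`M(i)%:F.
Proof.
move=> D; apply: is_der_ext (D) _ _.
  by apply: is_der_sum => i _; apply: is_der_partial.
by move=> i; rewrite sum_partialX.
Qed.

(** The product is linear in the differential of each entry: slot 0 is read off [wedge_diffl], later
    slots follow by induction. *)
Lemma is_der_dwedge s l (A : {set 'I_n}) : (l < size s)%N ->
  is_der (fun h => (dwedge (set_nth 0 s l h) A)%:F).
Proof.
elim: s l A => [//|a s IH] [|l] A /=; rewrite ?ltnS => ls.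
  have := is_der_sum (index_enum 'I_n) (P := mem A)
    (fun i => ((-1) ^+ below i A * dwedge s (A :\ i))%:F)
    (fun i _ => is_der_partial i).
  set d1 := (X in is_der X -> _); set d2 := (X in _ -> is_der X).
  suff E h : d2 h = d1 h by case=> D M C; split=> [x y|x y|x]; rewrite !E.
  rewrite /d1 /d2 dwedge_cons wedge_diffl raddf_sum /=; apply: eq_bigr => i _.
  by rewrite -iotaM; congr (_ %:F); rewrite -mulrA; congr (_ * _); rewrite mulrC.
have := is_der_sum (index_enum 'I_n) (P := mem A)
    (fun i => ((-1) ^+ below i A * a^`M(i))%:F)
    (fun i _ => IH l (A :\ i) ls).
set d1 := (X in is_der X -> _); set d2 := (X in _ -> is_der X).
suff E h : d2 h = d1 h by case=> D M C; split=> [x y|x y|x]; rewrite !E.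
rewrite /d1 /d2 dwedge_cons wedge_diffl raddf_sum /=; apply: eq_bigr => i _.
by rewrite -iotaM mulrA.
Qed.

(** * The basis of derivations dual to z *)

Section Dual.
Variables (z : seq R) (I : {set 'I_n}).
Hypothesis zI : dwedge z I != 0.

(* By Cramer's rule, [dual l] is the partial derivative by [z`_l] in the
   coordinates [z] and ['X_j], [j \notin I]. *)
Definition dual l (h : R) : K :=
  (dwedge (set_nth 0 z l h) I)%:F / (dwedge z I)%:F.

Lemma dual_der l : (l < size z)%N -> is_der (dual l).
Proof.
move=> lz; have := is_der_scale (dwedge z I)%:F^-1 (is_der_dwedge I lz).
by case=> A M C; split=> [x y|x y|x]; rewrite /dual ![_ / _]mulrC ?A ?M ?C.
Qed.

Lemma dual_nth l l' : (l < size z)%N -> (l' < size z)%N ->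
  dual l z`_l' = (l' == l)%:R.
Proof.
move=> lz l'z; rewrite /dual; case: eqP => [->|/eqP ne].
  have -> : set_nth 0 z l z`_l = z.
    apply: (@eq_from_nth _ 0) => [|i _].
      by rewrite size_set_nth; apply/maxn_idPr.
    by rewrite nth_set_nth /=; case: eqP => [->|].
  by rewrite divff ?iota_eq0.
have sz : size (set_nth 0 z l z`_l') = size z.
  by rewrite size_set_nth; apply/maxn_idPr.
(* Replacing z_l by a different z_l' repeats an entry, so the product vanishes. *)
rewrite dwedge_uniq ?ffunE ?iota0 ?mul0r //.
apply/negP => /(nth_uniq 0) U; have := U l l'.
rewrite sz => /(_ lz l'z); rewrite !nth_set_nth /= eqxx (negPf ne) eqxx.
by rewrite eq_sym (negPf ne).
Qed.

Lemma dual_var l j : (l < size z)%N -> j \notin I -> dual l 'X_j = 0.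
Proof.
move=> lz jI; rewrite /dual (@dwedge_var _ _ j) ?iota0 ?mul0r //.
by rewrite set_nthE lz mem_cat mem_head orbT.
Qed.

Lemma der_chain_I (d : R -> K) : is_der d -> (forall j, j \notin I -> d 'X_j = 0) ->
  forall h, d h = \sum_(a < #|I|) d 'X_(enum_val a) * h^`M(enum_val a)%:F.
Proof.
move=> D D0 h; rewrite (is_der_chain D) (bigID (mem I)) /=.
rewrite [X in _ + X]big1 ?addr0 => [|j /D0 ->]; last by rewrite mul0r.
by rewrite (big_enum_val (A := mem I)).
Qed.

(** By duality and the chain rule A is a left inverse of the Jacobian block B, hence a two-sided
    one. So v B = 0 forces d to vanish on the variables indexed by I. *)
Lemma der_eq0 (d : R -> K) : is_der d -> (forall l, (l < size z)%N -> d z`_l = 0) ->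
  (forall j, j \notin I -> d 'X_j = 0) -> forall h, d h = 0.
Proof.
move=> D dz dI; have sI : size z = #|I| by rewrite (dwedge_card zI).
pose A : 'M[K]_(size z, #|I|) := \matrix_(l, a) dual l 'X_(enum_val a).
pose B : 'M[K]_(#|I|, size z) := \matrix_(a, l) (z`_l)^`M(enum_val a)%:F.
have AB : A *m B = 1%:M.
  apply/matrixP => l l'; rewrite !mxE eq_sym -dual_nth ?ltn_ord //.
  rewrite (der_chain_I (dual_der (ltn_ord l))) => [|j]; last exact: dual_var.
  by apply: eq_bigr => a _; rewrite !mxE.
have BA := mulmx1_sq sI AB.
pose v : 'rV[K]_#|I| := \row_a d 'X_(enum_val a).
have vB : v *m B = 0.
  apply/rowP => l; rewrite !mxE -[RHS](dz l) // (der_chain_I D dI).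
  by apply: eq_bigr => a _; rewrite !mxE.
have v0 : v = 0 by rewrite -[v]mulmx1 -BA mulmxA vB mul0mx.
move=> h; rewrite (der_chain_I D dI) big1 // => a _.
by have /rowP/(_ a) := v0; rewrite !mxE => ->; rewrite mul0r.
Qed.

Lemma der_dual_expand (d : R -> K) :
  is_der d -> (forall j, j \notin I -> d 'X_j = 0) ->
  forall h, d h = \sum_(l < size z) d z`_l * dual l h.
Proof.
move=> D dI h; apply/eqP; rewrite -subr_eq0; apply/eqP; move: h.
apply: der_eq0.
- by apply: is_der_sub => //; apply: is_der_sum => l _; apply: dual_der.
- move=> l lz; rewrite (bigD1 (Ordinal lz)) //= dual_nth // eqxx mulr1.
  rewrite big1 ?addr0 ?subrr // => l' ne; rewrite dual_nth // eq_sym.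
  by rewrite -val_eqE /= in ne; rewrite (negPf ne) mulr0.
- by move=> j jI; rewrite dI // big1 ?subrr // => l _; rewrite dual_var ?mulr0.
Qed.

(** The numerator is a coefficient of dz with z_l replaced by h, so its bound trades deg z_l for deg
    h. *)
Lemma dual_fle (Gamma : orderedQVectType) (w : 'I_n -> Gamma) l h :
    (l < size z)%N ->
  fle w (dual l h) (fdeg w h +
    (\sum_(f <- z) fdeg w f - (fdeg w (dwedge z I) + \sum_(i in I) w i))
    - fdeg w z`_l).
Proof.
move=> lz; have := fle_div zI (wle_iota (dwedge_wle w (set_nth 0 z l h) I)).
move/fle_trans; apply.
have -> : \sum_(f <- z) fdeg w f =
    \sum_(f <- take l z) fdeg w f + (fdeg w z`_l + \sum_(f <- drop l.+1 z) fdeg w f).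
  by rewrite -[in LHS](cat_take_drop l z) (drop_nth 0 lz) big_cat big_cons.
rewrite set_nthE lz big_cat big_cons /=.
set x := \sum_(_ <- take _ _) _; set y := \sum_(_ <- drop _ _) _.
set h' := fdeg w h; set f := fdeg w z`_l; set J := fdeg w (dwedge z I).
set S := \sum_(i in I) w i.
rewrite [x + (f + y)]addrCA -[f + _ - _]addrA [h' + (f + _)]addrCA.
by rewrite [f + _ - f]addrAC subrr add0r [x + _]addrCA -!addrA -opprD [S + J]addrC.
Qed.

End Dual.

(** * Hasse-Schmidt derivations *)

Definition cst : k -> {poly K} := polyC \o iota \o @mpolyC n k.
HB.instance Definition _ := GRing.RMorphism.on cst.

(** Says that u |-> sum_i phi_i(u) T^i is additive and multiplicative modulo T^N, lifts the identity
    and fixes k. *)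
Definition hasse_schmidt N (phi : nat -> K -> K) : Prop :=
  [/\ phi 0%N =1 id,
      forall i, (i < N)%N -> {morph phi i : u v / u + v},
      forall i, (i < N)%N -> forall u v,
        phi i (u * v) = \sum_(j < i.+1) phi j u * phi (i - j)%N v
    & forall i, (0 < i < N)%N -> forall c : k, phi i c%:MP%:F = 0].

(** * Extension from polynomials to fractions *)

Section Extend.
Variables (N : nat) (Phi : {rmorphism R -> {poly K}}).
Hypothesis Phi0 : forall h, (Phi h)`_0 = h%:F.
Hypothesis PhiC : forall c, Phi c%:MP = cst c.

Fact numden_subproof (u : K) :
  exists x : R * R, (x.2 != 0) && (u == x.1%:F / x.2%:F).
Proof. by have [a [b [b0 ->]]] := iota_frac u; exists (a, b); rewrite b0 eqxx. Qed.

Definition numden (u : K) : R * R := sval (sigW (numden_subproof u)).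

Lemma numdenP u : (numden u).2 != 0 /\ u = (numden u).1%:F / (numden u).2%:F.
Proof. by rewrite /numden; case: sigW => x /= /andP[? /eqP]. Qed.

(** The quotient of the images of numerator and denominator modulo ['X^N]; by [frac_extE] the chosen
    representation does not matter there. *)
Definition frac_ext (u : K) : {poly K} :=
  Phi (numden u).1 * trinv N (Phi (numden u).2).

Lemma frac_extE u a b : b != 0 -> u = a%:F / b%:F ->
  eqX N (frac_ext u * Phi b) (Phi a).
Proof.
move=> b0 E; have [d0 Eu] := numdenP u.
apply: (@eqX_mulIr _ _ _ _ (Phi (numden u).2)); first by rewrite Phi0 iota_eq0.
have <- : Phi (numden u).1 * Phi b = Phi a * Phi (numden u).2.
  rewrite -!rmorphM; congr (Phi _); apply: iota_inj; rewrite !iotaM; apply/eqP.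
  by rewrite -eqr_div ?iota_eq0 // -Eu E.
have -> : frac_ext u * Phi b * Phi (numden u).2 =
    Phi (numden u).1 * Phi b * (Phi (numden u).2 * trinv N (Phi (numden u).2)).
  by rewrite /frac_ext; ring.
rewrite -[X in eqX _ _ X]mulr1; apply: eqXM => //.
by apply: trinvP; rewrite Phi0 iota_eq0.
Qed.

Lemma frac_ext_unique u a b q : b != 0 -> u = a%:F / b%:F ->
  eqX N (q * Phi b) (Phi a) -> eqX N (frac_ext u) q.
Proof.
move=> b0 E H; apply: (@eqX_mulIr _ _ _ _ (Phi b)).
  by rewrite Phi0 iota_eq0.
exact: eqX_trans (frac_extE b0 E) (eqX_sym H).
Qed.

Lemma frac_ext_hs : (0 < N)%N ->
  hasse_schmidt N (fun i u => (frac_ext u)`_i) /\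
  forall i h, (i < N)%N -> (frac_ext h%:F)`_i = (Phi h)`_i.
Proof.
move=> N0.
have EF i h : (i < N)%N -> (frac_ext h%:F)`_i = (Phi h)`_i.
  apply: (@frac_ext_unique _ h 1); rewrite ?oner_neq0 // ?iota1 ?divr1 //.
  by rewrite rmorph1 mulr1.
split=> //; split=> [u|i iN u v|i iN u v|i /andP[i0 iN] c].
- have [a [b [b0 E]]] := iota_frac u.
  have /(_ 0%N N0) := frac_extE b0 E.
  rewrite coefM big_ord1 !Phi0 => /(canRL (mulfK _)) ->.
    by rewrite E.
  by rewrite iota_eq0.
- have [a [b [b0 E]]] := iota_frac u; have [a' [b' [b'0 E']]] := iota_frac v.
  rewrite -coefD; apply: (@frac_ext_unique _ (a * b' + a' * b) (b * b')) => //.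
  + by rewrite mulf_neq0.
  + by rewrite E E' iotaD !iotaM addf_div ?iota_eq0.
  + rewrite mulrDl rmorphD !rmorphM /=; apply: eqXD.
      by rewrite mulrA; apply: eqXM => //; apply: frac_extE.
    by rewrite [Phi b * _]mulrC mulrA; apply: eqXM => //; apply: frac_extE.
- have [a [b [b0 E]]] := iota_frac u; have [a' [b' [b'0 E']]] := iota_frac v.
  rewrite -coefM; apply: (@frac_ext_unique _ (a * a') (b * b')) => //.
  + by rewrite mulf_neq0.
  + by rewrite E E' !iotaM mulf_div.
  + by rewrite !rmorphM /= mulrACA; apply: eqXM; apply: frac_extE.
- by rewrite EF // PhiC /cst /= coefC gtn_eqF.
Qed.

End Extend.

(** * Construction with prescribed values on z *)

Section Hensel.
Implicit Types (xi eta : 'I_n -> {poly K}).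

Definition psubst xi : R -> {poly K} := mmap cst xi.
HB.instance Definition _ xi := GRing.RMorphism.on (psubst xi).

Lemma psubstC xi c : psubst xi c%:MP = cst c.
Proof. exact: mmapC. Qed.

Lemma psubstX xi i : psubst xi 'X_i = xi i.
Proof. by rewrite /psubst mmapX mmap1U. Qed.

Lemma psubst0 xi : (forall i, (xi i)`_0 = ('X_i)%:F) ->
  forall h, (psubst xi h)`_0 = h%:F.
Proof.
move=> xi0; apply: mpoly_closure => [c|i|p q P Q|p q P Q].
- by rewrite psubstC /cst /= coefC.
- by rewrite psubstX xi0.
- by rewrite rmorphD /= coefD P Q iotaD.
- by rewrite rmorphM /= coefM big_ord1 P Q iotaM.
Qed.

Lemma poly_divX (p : {poly K}) : exists q, p = (p`_0)%:P + 'X * q.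
Proof.
exists (\poly_(i < (size p).-1) p`_i.+1); apply/polyP => i.
rewrite coefD coefC coefXM coef_poly; case: i => [|i] /=; first by rewrite addr0.
rewrite add0r; case: ifP => // /negbT; rewrite -leqNgt => H.
by rewrite nth_default // (leq_trans (leqSpred _)).
Qed.

Lemma psubst_taylor N xi (eta : 'I_n -> K) :
    (forall i, (xi i)`_0 = ('X_i)%:F) ->
  forall h, exists q,
    psubst (fun i => xi i + 'X^(N.+1) * (eta i)%:P) h
      = psubst xi h + 'X^(N.+1) * (\sum_i eta i * h^`M(i)%:F)%:P + 'X^(N.+2) * q.
Proof.
move=> xi0; set xi' := fun i => _.
have D : is_der (fun h : R => \sum_i eta i * h^`M(i)%:F).
  by apply: is_der_sum => i _; apply: is_der_partial.
set d := (X in is_der X) in D; rewrite -/d; case: D => dD dM dC.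
apply: mpoly_closure => [c|i|a b [q Ea] [q' Eb]|a b [q Ea] [q' Eb]].
- by exists 0; rewrite !psubstC -/(d _) dC polyC0 !mulr0 !addr0.
- by exists 0; rewrite !psubstX mulr0 addr0 sum_partialX.
- exists (q + q'); rewrite !rmorphD /= Ea Eb -!/(d _) dD polyCD; ring.
(* Modulo ['X] the image of a is a itself, so the cross terms give the Leibniz rule; the product of
   the two corrections has order 2N + 2 >= N + 2. *)
- have [a1 Ea1] := poly_divX (psubst xi a); have [b1 Eb1] := poly_divX (psubst xi b).
  rewrite !psubst0 // in Ea1 Eb1.
  rewrite !rmorphM /= Ea Eb -!/(d _) dM polyCD !polyCM.
  exists (a1 * (d b)%:P + b1 * (d a)%:P + psubst xi a * q' + psubst xi b * q
    + 'X^N * (d a)%:P * (d b)%:P + 'X^(N.+1) * (q * (d b)%:P + q' * (d a)%:P)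
    + 'X^(N.+2) * q * q').
  rewrite !exprS Ea1 Eb1; ring.
Qed.

Variables (z : seq R) (I : {set 'I_n}) (tau : nat -> {poly K}).
Hypothesis zI : dwedge z I != 0.
Hypothesis tau0 : forall l, (l < size z)%N -> (tau l)`_0 = (z`_l)%:F.

(* Newton's iteration for the system [psubst xi z`_l = tau l]. *)
Lemma hensel N : exists xi, [/\ forall i, (xi i)`_0 = ('X_i)%:F,
    forall l, (l < size z)%N -> eqX N.+1 (psubst xi z`_l) (tau l)
  & forall j, j \notin I -> xi j = (('X_j)%:F)%:P].
Proof.
elim: N => [|N [xi [xi0 xiz xiI]]].
  exists (fun i => (('X_i)%:F)%:P); split=> [i|l lz [] // _|//].
    exact: coefC.
  by rewrite psubst0 ?tau0 // => i; apply: coefC.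
(* [e] is the error left in degree N + 1; [eta] solves the Jacobian system with right-hand side [e]
   and vanishes outside I. *)
pose e l := (tau l)`_N.+1 - (psubst xi z`_l)`_N.+1.
pose eta i := \sum_(l < size z) e l * dual z I l 'X_i.
exists (fun i => xi i + 'X^(N.+1) * (eta i)%:P); split=> [i|l lz|j jI].
- by rewrite coefD coefXnM addr0.
- have [q ->] := psubst_taylor N eta xi0 z`_l.
  move=> i iN; rewrite !coefD !coefXnM iN addr0; move: iN; rewrite ltnS.
  rewrite leq_eqVlt => /orP[/eqP ->|iN]; last first.
    by rewrite iN addr0 xiz.
  rewrite ltnn subnn coefC /=.
  suff -> : \sum_i eta i * (z`_l^`M(i))%:F = e l by rewrite addrC subrK.
  transitivity (\sum_(l' < size z) e l' * dual z I l' z`_l).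
    under eq_bigr do rewrite mulr_suml.
    rewrite exchange_big; apply: eq_bigr => l' _ /=.
    rewrite [in RHS](is_der_chain (dual_der I (ltn_ord l'))) mulr_sumr.
    by apply: eq_bigr => i' _; rewrite -[LHS]mulrA.
  rewrite (bigD1 (Ordinal lz)) //= dual_nth // eqxx mulr1 big1 ?addr0 //.
  move=> l' ne; rewrite dual_nth // eq_sym.
  by rewrite -val_eqE /= in ne; rewrite (negPf ne) mulr0.
- by rewrite xiI // /eta big1 ?mulr0 ?addr0 // => l _; rewrite dual_var ?mulr0.
Qed.

Lemma hasse_schmidt_exists N : exists phi : nat -> K -> K,
  [/\ hasse_schmidt N.+1 phi,
      forall l i, (l < size z)%N -> (i <= N)%N -> phi i (z`_l)%:F = (tau l)`_i
    & forall j i, j \notin I -> (0 < i <= N)%N -> phi i ('X_j)%:F = 0].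
Proof.
have [xi [xi0 xiz xiI]] := hensel N.
have [HS E] := frac_ext_hs (psubst0 xi0) (psubstC xi) (ltn0Sn N).
exists (fun i u => (frac_ext N.+1 (psubst xi) u)`_i); split=> //.
- by move=> l i lz iN; rewrite E // xiz.
- move=> j i jI /andP[i0 iN]; rewrite E //= psubstX xiI // coefC gtn_eqF //.
Qed.

End Hensel.

(** * Composition of the components *)

Section Iterative.
Variables (z : seq R) (I : {set 'I_n}).
Hypothesis zI : dwedge z I != 0.
Variables (N : nat) (phi : nat -> K -> K).
Hypothesis HS : hasse_schmidt N phi.
Hypothesis phiX : forall j i, j \notin I -> (0 < i < N)%N -> phi i ('X_j)%:F = 0.
(* [phi i] is the [i]-th divided power of the partial derivative by [z`_0] in
   the separating coordinates [z] and ['X_j], [j \notin I]. *)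
Hypothesis phiz : forall l i, (l < size z)%N -> (0 < i < N)%N ->
  phi i (z`_l)%:F = ((l == 0%N) && (i == 1%N))%:R.

Lemma hs0 i : (i < N)%N -> phi i 0 = 0.
Proof.
case: HS => _ A _ _ iN; apply: (addrI (phi i 0)).
by rewrite -A // !addr0.
Qed.

Lemma hs_sum i (T : Type) (r : seq T) (P : pred T) (F : T -> K) : (i < N)%N ->
  phi i (\sum_(t <- r | P t) F t) = \sum_(t <- r | P t) phi i (F t).
Proof.
by case: HS => _ A _ _ iN; apply: big_morph; [apply: A | apply: hs0].
Qed.

Lemma hs1 i : (0 < i < N)%N -> phi i 1 = 0.
Proof.
by case: HS => _ _ _ C iN; have := C i iN 1; rewrite mpolyC1 iota1.
Qed.

(* The defect of the identity is, by induction, a derivation of [K] killing the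
   coordinates, hence zero. *)
Lemma hs_iter i j : (i + j < N)%N ->
  forall u, phi i (phi j u) = phi (i + j)%N u *+ 'C(i + j, i).
Proof.
have [P0 PD PM PC] := HS.
(* Induction on a bound s of i + j makes the identity available for all pairs of smaller total
   order. *)
move: {2}(i + j)%N (leqnn (i + j)) => s; elim: s i j => [|s IH] i j les ltN u.
  by move: les; rewrite leqn0 addn_eq0 => /andP[/eqP -> /eqP ->]; rewrite !P0 mulr1n.
have [->|i0] := posnP i; first by rewrite P0 bin0.
have [->|j0] := posnP j; first by rewrite addn0 P0 binn.
have iN : (i < N)%N by lia.
have jN : (j < N)%N by lia.
pose E v := phi i (phi j v) - phi (i + j)%N v *+ 'C(i + j, i).
suff E0 v : E v = 0 by apply/eqP; rewrite -subr_eq0; apply/eqP/E0.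
have ED : {morph E : a b / a + b}.
  by move=> a b; rewrite /E !PD // mulrnDl opprD addrACA.
have EM a b : E (a * b) = a * E b + b * E a.
  rewrite /E [phi j (a * b)]PM // hs_sum // PM //.
  (* [T] and [S] are the composites, [T'] and [S'] their expected values. By induction each pair
     agrees except at one corner of the box, (i, j) or (0, 0), where the defect [E a] or [E b]
     enters; these corners differ since i > 0. *)
  pose T x y := phi x (phi y a); pose T' x y := phi (x + y)%N a *+ 'C(x + y, x).
  pose S x y := phi x (phi y b); pose S' x y := phi (x + y)%N b *+ 'C(x + y, x).
  have ET x y : (x <= i)%N -> (y <= j)%N ->
      T x y = T' x y + ((x == i) && (y == j))%:R * E a.
    move=> xi yj; have [/andP[/eqP -> /eqP ->]|ne] := boolP (_ && _).
      by rewrite mul1r /T /T' /E addrC subrK.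
    rewrite mul0r addr0; apply: IH; move: ne; case: eqP; case: eqP => /=; lia.
  have ES x y : (x <= i)%N -> (y <= j)%N ->
      S (i - x)%N (j - y)%N =
        S' (i - x)%N (j - y)%N + ((x == 0%N) && (y == 0%N))%:R * E b.
    move=> xi yj; have [/andP[/eqP -> /eqP ->]|ne] := boolP (_ && _).
      by rewrite mul1r /S /S' /E !subn0 addrC subrK.
    rewrite mul0r addr0; apply: IH; move: ne; case: eqP; case: eqP => /=; lia.
  have -> : \sum_(y < j.+1) phi i (phi y a * phi (j - y)%N b) =
      \sum_(x < i.+1) \sum_(y < j.+1) (T' x y * S' (i - x)%N (j - y)%N
        + ((x == i :> nat) && (y == j :> nat))%:R * (E a * b)
        + ((x == 0%N :> nat) && (y == 0%N :> nat))%:R * (a * E b)).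
    rewrite exchange_big /=; apply: eq_bigr => y _; rewrite PM //.
    have yj : (y <= j)%N by rewrite -ltnS.
    apply: eq_bigr => x _; have xi : (x <= i)%N by rewrite -ltnS.
    rewrite -!/(T _ _) -!/(S _ _) ET // ES //.
    have [->|_] := nat_of_ord x =P i.
      rewrite (gtn_eqF i0) /= mul0r !addr0.
      have [->|_] := nat_of_ord y =P j; last by rewrite /= !mul0r !addr0.
      by rewrite mul0r addr0 !mul1r mulrDl /S' !subnn addn0 P0 bin0 mulr1n.
    rewrite /= !mul0r !addr0.
    have [->|_] := nat_of_ord x =P 0%N; last by rewrite /= !mul0r !addr0.
    have [->|_] := nat_of_ord y =P 0%N; last by rewrite /= !mul0r !addr0.
    by rewrite !mul1r mulrDr /T' addn0 P0 bin0 mulr1n.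
  under eq_bigr do rewrite !big_split /=.
  rewrite !big_split /=.
  have -> : \sum_(x < i.+1) \sum_(y < j.+1) T' x y * S' (i - x)%N (j - y)%N =
      (\sum_(m < (i + j).+1) phi m a * phi (i + j - m)%N b) *+ 'C(i + j, i).
    rewrite -sumrMnl -(vandermonde_box i j (fun m => phi m a * phi (i + j - m)%N b)).
    apply: eq_bigr => x _; have xi : (x <= i)%N by rewrite -ltnS.
    apply: eq_bigr => y _; have yj : (y <= j)%N by rewrite -ltnS.
    rewrite /T' /S' mulrnAl mulrnAr -mulrnA mulnC.
    by congr (_ * phi _ b *+ _); lia.
  have delta c (x0 : 'I_i.+1) (y0 : 'I_j.+1) : \sum_(x < i.+1) \sum_(y < j.+1)
      ((x == x0 :> nat) && (y == y0 :> nat))%:R * c = c :> K.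
    rewrite (bigD1 x0) //= (bigD1 y0) //= !eqxx mul1r !big1 ?addr0 //.
      move=> x /negPf nx; rewrite big1 // => y _.
      by move: nx; rewrite -val_eqE /= => ->; rewrite mul0r.
    by move=> y /negPf ny; move: ny; rewrite -val_eqE /= => ->; rewrite mul0r.
  rewrite (delta _ ord_max ord_max) (delta _ ord0 ord0) -PM //.
  rewrite -/(E a) -/(E b); move: (phi (i + j)%N (a * b) *+ _) (E a) (E b) => x y t.
  by ring.
have EF h : E h%:F = 0.
  move: h; apply: (der_eq0 zI).
  - split=> [a b|a b|c]; first by rewrite iotaD ED.
      by rewrite iotaM EM.
    by rewrite /E !PC ?mul0rn ?hs0 ?subrr //; lia.
  - move=> l lz; rewrite /E !phiz //; try lia.
    have -> : (i + j == 1)%N = false by lia.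
    rewrite andbF mul0rn subr0; case: (_ && _); last exact: hs0.
    by apply: hs1; lia.
  - by move=> l lI; rewrite /E !phiX ?hs0 ?mul0rn ?subrr //; lia.
(* With v = a / b, the product rule for [E] on v b = a, where [E] kills both polynomials a and b,
   leaves b E(v) = 0. *)
have [a [b [b0 Eu]]] := iota_frac v.
have := EM v b%:F; rewrite Eu divfK ?iota_eq0 // !EF mulr0 add0r => /esym/eqP.
by rewrite mulf_eq0 iota_eq0 (negPf b0) /= => /eqP.
Qed.

End Iterative.

(** * Action on P(g) *)

Section HasseHorner.
Variables (N : nat) (phi : nat -> K -> K).
Hypothesis HS : hasse_schmidt N phi.

Definition hs_const (h : {mpoly k[n]}) := forall i, (0 < i < N)%N -> phi i h%:F = 0.

Lemma hs_constM c u i : hs_const c -> (i < N)%N -> phi i (c%:F * u) = c%:F * phi i u.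
Proof.
have [P0 _ PM _] := HS; move=> Hc iN; rewrite PM // big_ord_recl /= P0 subn0.
rewrite big1 ?addr0 // => j _; rewrite /bump /= add1n Hc ?mul0r //.
by have := ltn_ord j; lia.
Qed.

Lemma hs_const_comp r (f : r.-tuple {mpoly k[n]}) q :
  (forall l, hs_const (tnth f l)) -> hs_const (q \mPo f).
Proof.
have [P0 PD PM PC] := HS; move=> Hf; move: q.
apply: mpoly_closure => [c|l|a b A B|a b A B].
- by move=> i iN; rewrite comp_mpolyC PC.
- by rewrite comp_mpolyXU -tnth_nth; apply: Hf.
- by move=> i iN; rewrite comp_mpolyD rmorphD PD ?A ?B ?addr0 //; case/andP: iN.
- move=> i iN; rewrite rmorphM rmorphM hs_constM ?B ?mulr0 //.
  by case/andP: iN.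
Qed.

(** The total map fixes the coefficients of P and sends g to g + T, hence P(g) to P(g + T), whose
    coefficient of T^i is the i-th Hasse derivative at g. The induction follows Horner's scheme. *)
Lemma hs_horner (g : {mpoly k[n]}) (P : {poly {mpoly k[n]}}) :
    (forall i, (0 < i < N)%N -> phi i g%:F = (i == 1%N)%:R) ->
    (forall j, hs_const P`_j) ->
  forall i, (i < N)%N -> phi i P.[g]%:F = P^`N(i).[g]%:F.
Proof.
have [P0 PD PM PC] := HS; move=> Hg; elim/poly_ind: P => [|P c IH] HP i iN.
  by rewrite horner0 rmorph0 (hs0 HS) // raddf0 horner0 rmorph0.
have {}IH : forall i, (i < N)%N -> phi i P.[g]%:F = P^`N(i).[g]%:F.
  apply: IH => j; have := HP j.+1.
  by rewrite coefD coefMX coefC /= addr0.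
have Hc : hs_const c by have := HP 0%N; rewrite coefD coefMX coefC /= add0r.
case: i iN => [|i] iN; first by rewrite P0 nderivn0.
rewrite nderivnMXaddC !hornerE !rmorphD !rmorphM /= PD // Hc // addr0 mulrC PM //.
rewrite big_ord_recl P0 subn0 IH // /bump /= mulrC addrC; congr (_ + _).
have i0 : (0 < i.+1)%N by [].
rewrite (bigD1 ord0) //= -[bump 0 0]/1%N Hg ?(leq_ltn_trans _ iN) //.
rewrite mul1r subn1 /= IH; last by lia.
rewrite big1 ?addr0 // => j j0; have ji := ltn_ord j; rewrite -[bump 0 j]/j.+1.
have j1 : (j.+1 == 1)%N = false by move: j0; rewrite -val_eqE /=; lia.
by rewrite Hg ?j1 ?mul0r //; lia.
Qed.

End HasseHorner.

(** * Degree growth of the components *)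

Section HasseBound.
Variables (z : seq R) (I : {set 'I_n}).
Hypothesis zI : dwedge z I != 0.
Hypothesis z_gt0 : (0 < size z)%N.
Variables (N : nat) (phi : nat -> K -> K).
Hypothesis HS : hasse_schmidt N phi.
Hypothesis phiX : forall j i, j \notin I -> (0 < i < N)%N -> phi i ('X_j)%:F = 0.
Hypothesis phiz : forall l i, (l < size z)%N -> (0 < i < N)%N ->
  phi i (z`_l)%:F = ((l == 0%N) && (i == 1%N))%:R.

Variables (p : nat) (Gamma : orderedQVectType) (w : 'I_n -> Gamma).
Hypothesis pK : p \in [pchar k].
Variables (lam Lam : Gamma).
Hypothesis LamE : Lam =
  \sum_(f <- z) fdeg w f - (fdeg w (dwedge z I) + \sum_(i in I) w i).
Hypothesis Lam_ge0 : 0 <= Lam.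
Hypothesis dual0_fle : forall h, fle w (dual z I 0%N h) (fdeg w h + lam).

Local Notation fle := (fle w).
Local Notation fdeg := (fdeg w).
Local Notation wle := (wle w).

(** The degree gain allowed to [phi i]; in the application lam is deg df - deg (df /\ dg) and Lam is
    [Lambda1]. *)
Definition shift i : Gamma := lam *+ i + Lam *+ logn p i`!.

(** Taking p-adic valuations in (i + j)! = C(i + j, i) i! j!. *)
Lemma shift_add i j :
  shift (i + j) = shift i + shift j + Lam *+ logn p 'C(i + j, i).
Proof.
have C0 : (0 < 'C(i + j, i))%N by rewrite bin_gt0 leq_addr.
have := bin_fact (leq_addr j i); rewrite addKn /shift => <-.
rewrite !lognM ?muln_gt0 ?fact_gt0 // !mulrnDr.
rewrite [X in _ + X]addrC !addrA; congr (_ + _).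
by rewrite -!addrA; congr (_ + _); rewrite addrCA.
Qed.

Lemma shift_le i j : (j <= i)%N -> shift j + shift (i - j) <= shift i.
Proof.
move=> ji; rewrite -[in X in _ <= X](subnKC ji) shift_add.
by rewrite -[X in X <= _]addr0 ogleD2l -(mulr0n Lam) ogle_mulrn.
Qed.

Lemma shift_le_dvd i j : (j <= i)%N -> (p %| 'C(i, j))%N ->
  shift j + shift (i - j) + Lam <= shift i.
Proof.
move=> ji pC; rewrite -[in X in _ <= X](subnKC ji) shift_add ogleD2l subnKC //.
rewrite -{1}(mulr1n Lam) ogle_mulrn //.
by rewrite logn_gt0 mem_primes (pcharf_prime pK) pC bin_gt0 ji.
Qed.

Lemma shift0 : shift 0 = 0.
Proof. by rewrite /shift fact0 logn1 !mulr0n addr0. Qed.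

Lemma shift1 : shift 1 = lam.
Proof. by rewrite /shift factS fact0 logn1 mulr0n mulr1n addr0. Qed.

Definition hs_bounded i := forall u c, fle u c -> fle (phi i u) (c + shift i).

(** With u = a / b, the Leibniz rule for u b = a is solved for [phi i u]; in the remaining terms u
    only meets orders j < i, and order i falls only on the polynomials a and b. *)
Lemma hs_bounded_frac i : (0 < i < N)%N ->
    (forall j, (j < i)%N -> hs_bounded j) ->
    (forall h, fle (phi i h%:F) (fdeg h + shift i)) ->
  hs_bounded i.
Proof.
have [_ PD PM _] := HS.
move=> /andP[i0 iN] IH Hi u c uc.
have [a [b [b0 E]]] := iota_frac u.
have bF : b%:F != 0 by rewrite iota_eq0.
have Ea : u * b%:F = a%:F by rewrite E divfK.
have -> : phi i u = (phi i a%:F - \sum_(j < i) phi j u * phi (i - j)%N b%:F) / b%:F.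
  apply: (canRL (mulfK bF)); rewrite -Ea PM // big_ord_recr /= subnn.
  by have [-> _ _ _] := HS; rewrite addrAC subrr add0r.
have -> : c + shift i = (c + shift i + fdeg b) - fdeg b by rewrite addrK.
apply: fle_div => //; apply: fleD => //.
  have [a0|a0] := eqVneq a 0; first by rewrite a0 iota0 (hs0 HS) //; apply: fle0.
  apply: fle_trans (Hi a) _; rewrite [c + _ + _]addrAC ogleD2r fdeg_le //.
  apply: fle_iota; rewrite -Ea; apply: fleM => //.
  exact/wle_iota/wle_fdeg.
apply: fleN; apply: fle_sum => // j _.
have jb : fle (phi (i - j)%N b%:F) (fdeg b + shift (i - j)).
  have [->|j0] := posnP j; first by rewrite subn0.
  by apply: IH; [lia | apply/wle_iota/wle_fdeg].
apply: fle_trans (fleM (IH j (ltn_ord j) _ _ uc) jb) _.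
by rewrite addrACA [X in _ <= X]addrAC ogleD2l shift_le // ltnW.
Qed.

(** Such an m is invertible in k, and constants have degree at most 0. *)
Lemma fle_natV c u m : ~~ (p %| m)%N -> fle (u *+ m) c -> fle u c.
Proof.
move=> pm H; have m0 : m%:R != 0 :> k by rewrite -(dvdn_pcharf pK).
have -> : u = ((m%:R^-1)%:MP)%:F * (u *+ m).
  rewrite -[u *+ m]mulr_natl mulrA -(rmorph_nat (iota \o @mpolyC n k)) /=.
  by rewrite -iotaM -mpolyCM mulVf // mpolyC1 iota1 mul1r.
by rewrite -[c]add0r; apply: fleM => //; apply/wle_iota/wleC.
Qed.

(* [i] is here a power of [p]. The map [psi] agrees with [phi i] up to the
   derivation [delta] and kills the variables, so on monomials it only involves
   products [phi j * phi (i - j)] with [0 < j < i], which [p %| 'C(i, j)] makes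
   better than required by one [Lam]; writing [delta] in the basis [dual] of
   derivations uses up this [Lam]. *)
Section Step.
Variable i : nat.
Hypothesis iN : (1 < i < N)%N.
Hypothesis IH : forall j, (j < i)%N -> hs_bounded j.
Hypothesis pbin : forall j, (0 < j < i)%N -> (p %| 'C(i, j))%N.

Let T := shift i - Lam.
Let delta (h : R) : K := \sum_l phi i ('X_l)%:F * (h^`M(l))%:F.
Let psi (h : R) : K := phi i h%:F - delta h.

Let delta_der : is_der delta.
Proof. by apply: is_der_sum => l _; apply: is_der_partial. Qed.

Let deltaX l : delta 'X_l = phi i ('X_l)%:F.
Proof.
exact: (sum_partialX (fun l => phi i ('X_l)%:F)).
Qed.

Let psiD a b : psi (a + b) = psi a + psi b.
Proof.
have [_ PD _ _] := HS; have [dD _ _] := delta_der.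
have iN' : (i < N)%N by case/andP: iN.
by rewrite /psi dD iotaD (PD _ iN') opprD addrACA.
Qed.

Let psiC c : psi c%:MP = 0.
Proof.
have [_ _ _ PC] := HS; have [_ _ dC] := delta_der.
have iN' : (0 < i < N)%N by lia.
by rewrite /psi (PC _ iN') dC subrr.
Qed.

Let psi_mul a b A B : wle a A -> wle b B -> fle (psi a) (A + T) ->
  fle (psi b) (B + T) -> fle (psi (a * b)) (A + B + T).
Proof.
move=> aA bB pa pb; have [P0 PD PM _] := HS; have [_ dM _] := delta_der.
(* The end terms j = 0 and j = i of the Leibniz sum combine with delta(ab) into the first two terms;
   only 0 < j < i remains. *)
have -> : psi (a * b) = a%:F * psi b + b%:F * psi a +
    \sum_(j < i.-1) phi j.+1 a%:F * phi (i - j.+1)%N b%:F.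
  rewrite /psi dM iotaM PM; last by case/andP: iN.
  rewrite -(ltn_predK (m := 0) (n := i)); last by lia.
  rewrite big_ord_recl big_ord_recr /= !P0 subn0 subnn P0 /bump /=.
  rewrite !mulrBr; under eq_bigr do rewrite add1n.
  ring.
apply: fleD => //; first apply: fleD => //.
- by rewrite -addrA; apply: fleM => //; apply: wle_iota.
- by rewrite [A + B]addrC -addrA; apply: fleM => //; apply: wle_iota.
apply: fle_sum => // j _; have ji := ltn_ord j.
have Ha : fle (phi j.+1 a%:F) (A + shift j.+1).
  by apply: IH; [lia | apply: wle_iota].
have Hb : fle (phi (i - j.+1)%N b%:F) (B + shift (i - j.+1)).
  by apply: IH; [lia | apply: wle_iota].
apply: fle_trans (fleM Ha Hb) _.
rewrite addrACA ogleD2l /T ogle_subr.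
by apply: shift_le_dvd; rewrite ?pbin //; lia.
Qed.

Let psi_mon m : fle (psi 'X_[m]) (Defs.mweight w m + T).
Proof.
pose Q m := fle (psi 'X_[m]) (Defs.mweight w m + T).
apply: (@mnm_closure _ Q) => [|l|{}m m' Hm Hm']; rewrite /Q.
- by rewrite mpolyX0 -mpolyC1 psiC; apply: fle0.
- by rewrite /psi deltaX subrr; apply: fle0.
- by rewrite mpolyXD mweightD; apply: psi_mul => //; apply: wleX.
Qed.

Let psi_fle h : fle (psi h) (fdeg h + T).
Proof.
rewrite {1}[h]mpolyE.
have -> : psi (\sum_(m <- msupp h) h@_m *: 'X_[m]) =
    \sum_(m <- msupp h) psi (h@_m *: 'X_[m]).
  by apply: big_morph => //; rewrite -mpolyC0.
rewrite big_seq; apply: fle_sum => // m hm.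
have mh : Defs.mweight w m + T <= fdeg h + T.
  by rewrite ogleD2r; have /allP := wle_fdeg w h; apply.
(* The scalar coefficient is treated as a factor of weight 0 on which [psi] vanishes. *)
apply: fle_trans mh; rewrite -mul_mpolyC -[Defs.mweight w m]add0r.
apply: psi_mul; [exact: wleC | exact: wleX | | exact: psi_mon].
by rewrite psiC; apply: fle0.
Qed.

Lemma hs_bounded_pow : hs_bounded i.
Proof.
have /andP[i1 iN'] := iN.
apply: hs_bounded_frac => //; first by rewrite iN' ltnW.
move=> h; have -> : phi i h%:F = psi h + delta h by rewrite /psi subrK.
apply: fleD => //.
  apply: fle_trans (psi_fle h) _.
  by rewrite ogleD2l /T ogle_subl -{1}[shift i]addr0 ogleD2l.
rewrite (der_dual_expand zI delta_der) => [|j jI]; last first.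
  by rewrite deltaX phiX // ltnW.
apply: fle_sum => // l _.
(* Since i > 1, [phi i] kills z_l, so on z_l the derivation inherits the better bound of [psi]. *)
have -> : delta z`_l = - psi z`_l.
  rewrite /psi phiz ?ltn_ord // ?(ltnW i1) // [i == 1%N]gtn_eqF // andbF.
  by rewrite opprB subr0.
have H := dual_fle zI w h (ltn_ord l).
apply: fle_trans (fleM (fleN (psi_fle z`_l)) H) _.
rewrite -LamE /T addrC [_ + (shift i - Lam)]addrC addrA addrAC subrK.
by rewrite addrAC addrA subrK.
Qed.

End Step.

Lemma hs_bound i : (i < N)%N -> hs_bounded i.
Proof.
have [P0 _ _ _] := HS.
elim/ltn_ind: i => i IH iN; have {}IH j : (j < i)%N -> hs_bounded j.
  by move=> ji; apply: IH => //; apply: ltn_trans iN.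
case: i => [|[|i]] in IH iN *; first by move=> u c; rewrite P0 shift0 addr0.
  apply: hs_bounded_frac => //.
  (* Both sides are derivations with the same values on z and on the variables outside I, so order
     one is covered by [dual0_fle]. *)
  suff E h : phi 1 h%:F = dual z I 0 h.
    by move=> h; rewrite E shift1.
  have [_ PD PM PC] := HS.
  apply/eqP; rewrite -subr_eq0; apply/eqP; move: h.
  apply: (der_eq0 zI).
  - apply: is_der_sub; last exact: dual_der.
    split=> [a b|a b|c]; rewrite ?iotaD ?PD ?iotaM ?PM ?PC //.
    by rewrite big_ord_recl big_ord1 /= P0 [X in _ + X]mulrC P0.
  - by move=> l lz; rewrite phiz // dual_nth // andbT subrr.
  - by move=> j jI; rewrite phiX // dual_var // subrr.
(* Either p divides every middle binomial, or one of them is a unit and [hs_iter] factors the map up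
   to that unit. *)
have [/forallP H|] := boolP [forall j : 'I_i.+2, (0 < j)%N ==> (p %| 'C(i.+2, j))%N].
  apply: hs_bounded_pow => // j /andP[j0 ji].
  by have := H (Ordinal ji); rewrite j0.
rewrite negb_forall => /existsP[[j ji]]; rewrite negb_imply /= => /andP[j0 pC].
move=> u c uc; apply: fle_natV pC _.
have -> : phi i.+2 u *+ 'C(i.+2, j) = phi j (phi (i.+2 - j)%N u).
  by rewrite (hs_iter zI HS phiX phiz) subnKC // ltnW.
have H1 : fle (phi (i.+2 - j)%N u) (c + shift (i.+2 - j)).
  by apply: IH uc; lia.
apply: fle_trans (IH j ji _ _ H1) _.
by rewrite -addrA ogleD2l addrC shift_le // ltnW.
Qed.

End HasseBound.

End FractionField.

(** * Fractions of polynomials and the degree estimate for P(g) *)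

Lemma tofrac_inj (R : idomainType) : injective (@tofrac R).
Proof. by move=> a b /eqP; rewrite tofrac_eq => /eqP. Qed.

Lemma fraction_fieldP (R : idomainType) (u : {fraction R}) :
  exists a b : R, b != 0 /\ u = tofrac a / tofrac b.
Proof.
have d0 x : \d_x != 0 :> R by apply: denom_ratioP.
exists \n_(repr u), \d_(repr u); split=> //.
apply: (canRL (mulfK _)); first by rewrite tofrac_eq0 d0.
rewrite -[X in X * _]reprK; unlock tofrac.
rewrite -[LHS]FracField.pi_mul; apply/eqmodP.
rewrite /= FracField.equivfE /FracField.mulf !numden_Ratio.
- by rewrite !mulr1 mulrC.
all: by rewrite ?mulr1 ?oner_neq0 ?d0.
Qed.

Theorem theorem1p10 (k : fieldType) (p : nat) (hp : p \in [pchar k])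
    (Gamma : orderedQVectType) (n : nat) (w : 'I_n -> Gamma)
    (hw : forall i : 'I_n, 0 < w i)
    (r : nat) (hr : (1 <= r)%N)
    (f : r.-tuple {mpoly k[n]}) (g : {mpoly k[n]})
    (hfg : wedge (diff_tuple f) (diff g) != 0)
    (P : {poly {mpoly k[n]}}) (hP0 : P != 0)
    (hP : forall i : nat, in_subalgebra f P`_i) :
  xle (Some (xfin (wdegT w (xfin (wdeg w g)) P)
             - Lambda0 w f g *+ init_mult w g P
             - Lambda1 w f g *+ logn p (init_mult w g P)`!))
      (wdeg w P.[g]).
Proof.
set omega := wedge (diff_tuple f) (diff g) in hfg.
(* I realizes deg (df /\ dg), so both Lambdas can be read off a single coefficient. *)
have [I nzI dI] := wdeg_form_attained w hfg.
(* g comes first because the derivation is taken along z_0; dg /\ df differs from df /\ dg only by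
   signs of coefficients. *)
pose z : seq {mpoly k[n]} := g :: f; pose m := init_mult w g P.
pose W := \sum_(i in I) w i.
have omegaE : omega I = (-1) ^+ #|I|.-1 * dwedge z I.
  by rewrite /omega wedge_diffr diff_tupleE -dwedge_cons.
have zI : dwedge z I != 0.
  by apply: contraNneq nzI => E; rewrite omegaE E mulr0.
have dE : xfin (wdeg_form w omega) = fdeg w (dwedge z I) + W.
  by rewrite dI omegaE fdeg_signM.
have LamE : Lambda1 w f g =
    \sum_(h <- z) fdeg w h - (fdeg w (dwedge z I) + W).
  rewrite /Lambda1 -/omega dE big_cons big_tuple; congr (_ - _).
  exact: addrC.
have Lam_ge0 : 0 <= Lambda1 w f g.
  rewrite LamE ogle_subr add0r -ogle_subr fdeg_le //; exact: dwedge_wle.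
pose lam := xfin (wdeg_form w (diff_tuple f)) - xfin (wdeg_form w omega).
have Lam0E : Lambda0 w f g = lam + fdeg w g.
  by rewrite /Lambda0 -/omega /lam addrAC.
have inj := @tofrac_inj {mpoly k[n]}.
have frac := @fraction_fieldP {mpoly k[n]}.
(* This is a coefficient of dh /\ df over one of dg /\ df. Bounding df as a whole gives deg df,
   sharper than the sum of the deg f_i in [dual_fle]. *)
have dual0 h : fle (@tofrac _) w (dual (@tofrac _) z I 0 h) (fdeg w h + lam).
  have := wle_wedge_diff w h (diff_tuple f) I.
  rewrite diff_tupleE -dwedge_cons => /(wle_iota (@tofrac _)) /(fle_div zI).
  rewrite (_ : _ + _ - W - _ = fdeg w h + lam) //.
  by rewrite /lam dE diff_tupleE opprD !addrA addrAC.
(* g is sent to g + T and every f_i to itself. *)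
pose tau l : {poly {fraction {mpoly k[n]}}} :=
  (tofrac z`_l)%:P + (if l == 0%N then 'X else 0).
have tau0 l : (l < size z)%N -> (tau l)`_0 = tofrac z`_l.
  by move=> _; rewrite coefD coefC; case: ifP; rewrite ?coefX ?coef0 addr0.
have [phi [HS phiz phiX]] := hasse_schmidt_exists inj frac zI tau0 m.+1.
have {}phiz l i : (l < size z)%N -> (0 < i < m.+2)%N ->
    phi i (tofrac z`_l) = ((l == 0%N) && (i == 1%N))%:R.
  move=> lz /andP[i0 iN]; rewrite phiz // coefD coefC gtn_eqF // add0r.
  by case: eqP; rewrite ?coefX ?coef0.
have bound := hs_bound inj frac zI (ltn0Sn _) HS phiX phiz hp LamE Lam_ge0 dual0.
have constf l : hs_const (@tofrac _) m.+2 phi (tnth f l).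
  move=> i iN; have := phiz l.+1 i; rewrite /= -tnth_nth => -> //.
  by rewrite ltnS size_tuple.
have constP j : hs_const (@tofrac _) m.+2 phi P`_j.
  by have [q ->] := hP j; apply: hs_const_comp.
have phig i : (0 < i < m.+2)%N -> phi i (tofrac g) = (i == 1%N)%:R.
  by move=> iN; rewrite (phiz 0%N).
have phiP : phi m (tofrac P.[g]) = tofrac P^`N(m).[g].
  by apply: (hs_horner HS).
have nzm := wcomp_nderivn_init_mult w g hP0; rewrite -/m in nzm.
(* If P(g) were 0, so would be its image under [phi m], the m-th Hasse derivative at g, which has a
   nonzero component. So the degree of P(g) is finite. *)
have nzP : P.[g] != 0.
  apply: contraNneq nzm => Pg; rewrite (_ : P^`N(m).[g] = 0) ?wcomp0 //.
  by apply: inj; rewrite -phiP Pg tofrac0 (hs0 HS).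
(* The nonzero component of weight deg P - m deg g lies in an element of degree at most deg P(g) +
   [shift m]; with Lambda0 = lam + deg g this is the claim. *)
have := bound m (leqnSn _) _ _ (wle_iota (@tofrac _) (wle_fdeg w P.[g])).
rewrite phiP => /(fle_iota inj) /wcomp_neq0_le /(_ nzm).
rewrite [wdeg w P.[g]]wdeg_fdeg //= -/(fdeg w g) -/m /shift Lam0E ogle_subl => H.
rewrite !ogle_subl [(lam + _) *+ m]mulrnDl addrA; apply: le_trans H _.
by rewrite [lam *+ m + _]addrC addrA.
Qed.
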